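(* The following two problems are $\Pi^1_1$-hard: (1) given a timed Büchi automaton $\mathcal{A}$, determine whether $L_\omega(\mathcal{A})$ is accepted by some deterministic timed Büchi automaton; (2) given a timed Büchi automaton $\mathcal{A}$ over a finite alphabet $\Sigma$, determine whether the complement $L_\omega(\mathcal{A})^c=(\mathcal{R}\times\Sigma)^\omega\setminus L_\omega(\mathcal{A})$ is accepted by some timed Büchi automaton.
   Context: $\mathcal{R}$ denotes the set of positive reals. An infinite timed word over a finite alphabet $\Sigma$ is a sequence $t_1.a_1.t_2.a_2.t_3.a_3\ldots$ with $t_i\in\mathcal{R}$ and $a_i\in\Sigma$; the set of these is $(\mathcal{R}\times\Sigma)^\omega$. A timed Büchi automaton (Alur–Dill) has finitely many real-valued clocks (growing at rate 1), finitely many states with initial states and a set of accepting states, and finitely many transitions each labelled by a letter of $\Sigma$, carrying a diagonal-free clock guard (Boolean combination of constraints $x\sim c$, $c$ a nonnegative integer) and a set of clocks to reset; an infinite timed word is accepted if some run on it visits accepting states infinitely often, and $L_\omega(\mathcal{A})$ is the set of accepted infinite timed words. It is deterministic if it has a single start state and transitions from the same state with the same label have mutually exclusive guards. $\Pi^1_1$ is the corresponding class of the analytical hierarchy; a problem is $\Pi^1_1$-hard if every $\Pi^1_1$ set reduces to it. *)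

(* Defs.v *)
From HB Require Import structures.
From mathcomp Require Import all_boot all_order all_algebra.
From mathcomp Require Import boolp classical_sets reals interval_inference.

Set Implicit Arguments.
Unset Strict Implicit.
Unset Printing Implicit Defensive.

Import Order.TTheory GRing.Theory Num.Theory.

Local Open Scope classical_set_scope.
Local Open Scope nat_scope.

(* Total recursive functions: the closure of the basic functions under
   composition, primitive recursion and minimization of regular functions
   (those for which the minimum exists for every value of the parameters). *)
Inductive recursive : forall k, (k.-tuple nat -> nat) -> Prop :=
| rec_zero k : @recursive k (fun=> 0)
| rec_succ : @recursive 1 (fun v => (thead v).+1)
| rec_proj k (i : 'I_k) : @recursive k (fun v => tnth v i)
| rec_comp m k (g : m.-tuple nat -> nat) (h : 'I_m -> k.-tuple nat -> nat) :
    recursive g -> (forall i, recursive (h i)) ->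
    recursive (fun v => g [tuple h i v | i < m])
| rec_primrec k (f : k.-tuple nat -> nat) (g : k.+2.-tuple nat -> nat) :
    recursive f -> recursive g ->
    @recursive k.+1 (fun v =>
      iteri (thead v) (fun y r => g [tuple of y :: r :: behead_tuple v])
        (f (behead_tuple v)))
| rec_min k (f : k.+1.-tuple nat -> nat) (g : k.-tuple nat -> nat) :
    recursive f ->
    (forall v, f [tuple of g v :: v] = 0 /\
       (forall y, y < g v -> f [tuple of y :: v] <> 0)) ->
    recursive g
| rec_ext k (f g : k.-tuple nat -> nat) : f =1 g -> recursive f -> recursive g.

Definition computable (f : nat -> nat) : Prop :=
  @recursive 1 (fun v => f (thead v)).

(* Variables of both sorts are de Bruijn indices, counted separately for the
   number variables and the set variables. *)
Inductive term :=
| TVar of nat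
| TZero
| TSucc of term
| TAdd of term & term
| TMul of term & term.

Inductive form :=
| FEq of term & term
| FLt of term & term
| FMem of term & nat
| FNot of form
| FAnd of form & form
| FOr of form & form
| FImp of form & form
| FAll of form
| FEx of form
| FAllSet of form
| FExSet of form.

Definition scons (T : Type) (x : T) (e : nat -> T) (i : nat) : T :=
  if i is j.+1 then e j else x.

Fixpoint teval (e : nat -> nat) (t : term) : nat :=
  match t with
  | TVar i => e i
  | TZero => 0
  | TSucc t => (teval e t).+1
  | TAdd t u => teval e t + teval e u
  | TMul t u => teval e t * teval e u
  end.

Fixpoint holds (e : nat -> nat) (E : nat -> set nat) (phi : form) : Prop :=
  match phi with
  | FEq t u => teval e t = teval e u
  | FLt t u => teval e t < teval e u
  | FMem t X => E X (teval e t)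
  | FNot p => ~ holds e E p
  | FAnd p q => holds e E p /\ holds e E q
  | FOr p q => holds e E p \/ holds e E q
  | FImp p q => holds e E p -> holds e E q
  | FAll p => forall n : nat, holds (scons n e) E p
  | FEx p => exists n : nat, holds (scons n e) E p
  | FAllSet p => forall X : set nat, holds e (scons X E) p
  | FExSet p => exists X : set nat, holds e (scons X E) p
  end.

Fixpoint arithmetical (phi : form) : bool :=
  match phi with
  | FEq _ _ | FLt _ _ | FMem _ _ => true
  | FNot p | FAll p | FEx p => arithmetical p
  | FAnd p q | FOr p q | FImp p q => arithmetical p && arithmetical q
  | FAllSet _ | FExSet _ => false
  end.

Fixpoint pi11_form (phi : form) : bool :=
  if phi is FAllSet p then pi11_form p else arithmetical phi.

(* Lightface: the quantification over [e] and [E] forbids parameters, only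
   the number variable 0 is effectively free in the defining formula. *)
Definition pi11 (B : set nat) : Prop :=
  exists2 phi, pi11_form phi &
    forall n (e : nat -> nat) (E : nat -> set nat),
      B n <-> holds (scons n e) E phi.

(* A decision problem is a set [P] of instances, which [code] presents as
   natural numbers; the reduction is many-one. *)
Definition pi11_hard (T : Type) (code : T -> nat) (P : set T) : Prop :=
  forall B : set nat, pi11 B ->
    exists2 F : nat -> T, computable (fun n => code (F n)) &
      forall n, B n <-> P (F n).

Variant cmp := CLt | CLe | CEq | CGe | CGt.

(* Guards over the clocks ['I_m]. *)
Inductive guard (m : nat) :=
| GTrue
| GCmp of 'I_m & cmp & nat
| GNot of guard m
| GAnd of guard m & guard m
| GOr of guard m & guard m.
Arguments GTrue {m}.

Definition cmp_code (r : cmp) : nat :=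
  match r with CLt => 0 | CLe => 1 | CEq => 2 | CGe => 3 | CGt => 4 end.

Fixpoint guard_code m (g : guard m) : nat :=
  match g with
  | GTrue => CodeSeq.code [:: 0]
  | GCmp x r c => CodeSeq.code [:: 1; val x; cmp_code r; c]
  | GNot g => CodeSeq.code [:: 2; guard_code g]
  | GAnd g h => CodeSeq.code [:: 3; guard_code g; guard_code h]
  | GOr g h => CodeSeq.code [:: 4; guard_code g; guard_code h]
  end.

(* Transitions over the letters ['I_k], states ['I_n] and clocks ['I_m]. *)
Record transition (k n m : nat) := Transition {
  source : 'I_n;
  label : 'I_k;
  cond : guard m;
  resets : {set 'I_m};
  target : 'I_n }.

Definition ord_set_code n (A : {set 'I_n}) : nat :=
  CodeSeq.code [seq val i | i <- enum A].

Definition transition_code k n m (e : transition k n m) : nat :=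
  CodeSeq.code [:: val (source e); val (label e); guard_code (cond e);
                   ord_set_code (resets e); val (target e)].

Lemma code_inj : injective CodeSeq.code.
Proof. exact: can_inj CodeSeq.codeK. Qed.

Lemma cmp_code_inj : injective cmp_code.
Proof. by case; case. Qed.

Lemma guard_code_inj m : injective (@guard_code m).
Proof.
elim=> [|x r c|g IHg|g IHg h IHh|g IHg h IHh] [|y s d|g'|g' h'|g' h'] //.
all: move=> /code_inj e; case: e => //.
- by move=> /val_inj -> /cmp_code_inj -> ->.
- by move=> /IHg ->.
- by move=> /IHg -> /IHh ->.
- by move=> /IHg -> /IHh ->.
Qed.

Lemma ord_set_code_inj n : injective (@ord_set_code n).
Proof.
move=> A B /code_inj /(inj_map val_inj) eAB.
by apply/setP => i; rewrite -[i \in A]mem_enum eAB mem_enum.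
Qed.

Lemma transition_code_inj k n m : injective (@transition_code k n m).
Proof.
move=> [s a g r t] [s' a' g' r' t'] /code_inj[] /=.
by move=> /val_inj-> /val_inj-> /guard_code_inj-> /ord_set_code_inj-> /val_inj->.
Qed.

HB.instance Definition _ k n m :=
  Equality.copy (transition k n m) (inj_type (@transition_code_inj k n m)).

(* Timed Buchi automata over the alphabet ['I_k]. *)
Record tba (k : nat) := TBA {
  nstates : nat;
  nclocks : nat;
  initial : {set 'I_nstates};
  accepting : {set 'I_nstates};
  transitions : seq (transition k nstates nclocks) }.

(* The alphabet is part of the input. *)
Definition tba_instance : Type := {k : nat & tba k}.

Definition tba_code (A : tba_instance) : nat :=
  CodeSeq.code [:: tag A; nstates (tagged A); nclocks (tagged A);
    ord_set_code (initial (tagged A)); ord_set_code (accepting (tagged A));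
    CodeSeq.code (map (@transition_code _ _ _) (transitions (tagged A)))].

Lemma tba_code_inj : injective tba_code.
Proof.
move=> [k [n m i a t]] [k' [n' m' i' a' t']] /code_inj[] /= ek en em.
case: _ / ek t' => t'; case: _ / en i' a' t' => i' a' t'.
case: _ / em t' => t'.
move=> /ord_set_code_inj-> /ord_set_code_inj->.
by move=> /code_inj /(inj_map (@transition_code_inj _ _ _)) ->.
Qed.

Section Semantics.
Variable R : realType.
Local Open Scope ring_scope.

(* Infinite timed words t_1.a_1.t_2.a_2 ...: [w i] is the pair formed by the
   time elapsed just before the event of index [i] and this event. No
   divergence of time is required. *)
Definition timed_word (k : nat) : Type := nat -> {posnum R} * 'I_k.

Definition cmp_sat (r : cmp) (x y : R) : bool :=
  match r with
  | CLt => x < y | CLe => x <= y | CEq => x == y | CGe => x >= y | CGt => x > y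
  end.

Fixpoint guard_sat m (v : 'I_m -> R) (g : guard m) : bool :=
  match g with
  | GTrue => true
  | GCmp x r c => cmp_sat r (v x) c%:R
  | GNot g => ~~ guard_sat v g
  | GAnd g h => guard_sat v g && guard_sat v h
  | GOr g h => guard_sat v g || guard_sat v h
  end.

(* [q i] and [v i] are the state and the clock valuation reached after [i]
   events, [e i] is the transition taken at the event of index [i]. *)
Definition is_run k (A : tba k) (w : timed_word k)
    (q : nat -> 'I_(nstates A)) (v : nat -> 'I_(nclocks A) -> R)
    (e : nat -> transition k (nstates A) (nclocks A)) : Prop :=
  [/\ q 0%N \in initial A,
      (forall x, v 0%N x = 0) &
      forall i, let elapsed x := v i x + (w i).1%:num in
        [/\ e i \in transitions A,
            source (e i) = q i /\ target (e i) = q i.+1,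
            label (e i) = (w i).2,
            guard_sat elapsed (cond (e i)) &
            forall x, v i.+1 x = if x \in resets (e i) then 0 else elapsed x]].

Definition lang k (A : tba k) : set (timed_word k) :=
  [set w | exists q v e, @is_run k A w q v e /\
     forall N : nat, exists2 i : nat, (N <= i)%N & q i \in accepting A].

Definition deterministic k (A : tba k) : Prop :=
  #|initial A| = 1%N /\
  forall e f, e \in transitions A -> f \in transitions A -> e <> f ->
    source e = source f -> label e = label f ->
    forall v : 'I_(nclocks A) -> R, (forall x, 0 <= v x) ->
      ~ (guard_sat v (cond e) /\ guard_sat v (cond f)).

Definition determinizable k (A : tba k) : Prop :=
  exists2 D : tba k, deterministic D & lang D = lang A.

Definition complementable k (A : tba k) : Prop :=
  exists B : tba k, lang B = ~` lang A.

End Semantics.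

(* Main.v *)
(** By Tarski's truth definition, the complement of a Pi^1_1 set consists of the
    [n] for which some oracle [W] satisfies [forall m, exists y, Q W n m y] with
    [Q] decidable in [W]: [W] stores the set variables and the truth values of
    the quantified subformulas. Equivalently, a fixed counter machine with
    oracle [W], started on [n], visits a given state infinitely often.

    The run of such a machine is written as a timed word in which the
    configuration at time [j] is a row of [j.+1] cells placed in the time
    interval [[j, j + 1)], each row being copied, up to local changes, exactly
    one time unit later. A timed automaton guesses and checks a violation of
    this format, so that it accepts all words except the encodings of the
    recurrent runs; the input [n] only occurs as a constant of its guards.

    In front of the encoding, a block of letters [a] is allowed, and the word is
    also accepted when two of these letters are at distance exactly 1. Without
    recurrent run, the automaton is universal. With one, an automaton for the
    complement, or a deterministic one, would have to remember the times of an
    unbounded number of letters [a] with its finitely many clocks: an event whose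
    time is not stored can be moved to distance 1 of an earlier one without
    affecting the run. *)

From HB Require Import structures.
From mathcomp Require Import all_boot all_order all_algebra.
From mathcomp Require Import boolp classical_sets reals interval_inference.
From mathcomp Require Import zify lra.
Require Import Defs.

Set Implicit Arguments.
Unset Strict Implicit.
Unset Printing Implicit Defensive.

Import Order.TTheory GRing.Theory Num.Theory.

Local Open Scope classical_set_scope.
Local Open Scope nat_scope.

(** * Codes of automata are computable *)

(** A violation must be found by following one guessed event with two clocks. Copying at distance
    exactly 1 prevents cells from being lost but not from being inserted; hence the condition that
    between the copies of two neighbours only [cnew] cells occur. Rows grow because a register is at
    most [j] at time [j]: its value is then an index of the row, and a zero test or an oracle query
    becomes a local property of the one cell with the tested index. The cell appended as index [i]
    carries a freely chosen oracle bit, copied by all later rows: this is how the quantifier over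
    [W] enters the language. Only two constraints mention [n]; they end an initial phase in which
    register 0 counts the rows, so that states are the same for all inputs. For an automaton with
    [m] clocks, take [N = m + m + 1] letters in each of two time units: a unit gap between the
    letters [i] and [N + i] goes unnoticed if no clock holds [i] at the end of the first half or
    [N + i] at the end of the block, which excludes at most [m + m] indices. *)

Lemma recursive_comp1 k (f : nat -> nat) (g : k.-tuple nat -> nat) :
  computable f -> recursive g -> recursive (fun v => f (g v)).
Proof.
move=> cf rg; apply: rec_ext (rec_comp (h := fun _ : 'I_1 => g) cf (fun=> rg)).
by move=> v /=; rewrite /thead tnth_mktuple.
Qed.

Lemma computable_comp f g :
  computable f -> computable g -> computable (fun n => f (g n)).
Proof. by move=> cf cg; exact: recursive_comp1 cf cg. Qed.

Lemma computable_succ : computable succn.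
Proof. exact: rec_succ. Qed.

Lemma computable_const c : computable (fun=> c).
Proof.
elim: c => [|c IHc]; first exact: rec_zero.
exact: computable_comp computable_succ IHc.
Qed.

Lemma computable_double : computable double.
Proof.
have r2 : @recursive 2 (fun v => (tnth v (lift ord0 ord0)).+2).
  do 2!apply: (recursive_comp1 computable_succ).
  exact: (rec_proj (lift ord0 ord0 : 'I_2)).
apply: rec_ext (rec_primrec (rec_zero 0) r2) => v /=.
by elim: (thead v) => [|n IHn] //=; rewrite IHn.
Qed.

(** [CodeSeq.code] is a fold of this function, which is what makes the code of a list with
    computable entries computable. The recursion on the exponent doubles, starting from the odd
    factor. *)
Lemma recursive_cons_code :
  @recursive 2 (fun v => 2 ^ thead v * (tnth v (lift ord0 ord0)).*2.+1).
Proof.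
have r3 : @recursive 3 (fun v => (tnth v (lift ord0 ord0)).*2).
  exact: recursive_comp1 computable_double (rec_proj (lift ord0 ord0 : 'I_3)).
have r1 := computable_comp computable_succ computable_double.
apply: rec_ext (rec_primrec r1 r3) => v /=.
have -> : thead (behead_tuple v) = tnth v (lift ord0 ord0).
  by rewrite /thead !(tnth_nth 0) /= nth_behead.
elim: (thead v) => [|n IHn] /=; first by rewrite mul1n.
by rewrite (tnth_nth 0) /= IHn expnS -mulnA mul2n.
Qed.

Lemma computable_cons_code f g : computable f -> computable g ->
  computable (fun n => 2 ^ f n * (g n).*2.+1).
Proof.
move=> cf cg.
have ch (i : 'I_2) : recursive (fun v => if i == ord0 then f (@thead 0 nat v) else g (thead v)).
  by case: (i == ord0).
apply: rec_ext (rec_comp recursive_cons_code ch) => v /=.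
by rewrite /thead !tnth_mktuple.
Qed.

Lemma computable_code (I : Type) (s : seq I) (f : I -> nat -> nat) :
  (forall i, computable (f i)) ->
  computable (fun n => CodeSeq.code [seq f i n | i <- s]).
Proof.
move=> cf; elim: s => [|i s IHs]; first exact: computable_const.
exact: computable_cons_code (cf i) IHs.
Qed.

(** * Expressions and machine programs *)

(** Iteration is bounded, so evaluation is total: expressions only have to decide [checks] relative
    to the oracle, the search for a witness being left to the machine. *)
Inductive exp :=
| EVar of nat
| EZero
| ESucc of exp
| EPred of exp
| EIter of exp & exp & exp
| EQry of exp.

(* [EIter a b h] binds the accumulator as the variable 0 of [h]. *)
Fixpoint eval (W : pred nat) (e : exp) (rho : nat -> nat) : nat :=
  match e with
  | EVar i => rho i
  | EZero => 0
  | ESucc a => (eval W a rho).+1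
  | EPred a => (eval W a rho).-1
  | EIter a b h =>
      iter (eval W a rho) (fun x => eval W h (scons x rho)) (eval W b rho)
  | EQry a => W (eval W a rho)
  end.

Lemma eval_qry W a rho : eval W (EQry a) rho = W (eval W a rho).
Proof. by []. Qed.

Fixpoint ren (f : nat -> nat) (e : exp) : exp :=
  match e with
  | EVar i => EVar (f i)
  | EZero => EZero
  | ESucc a => ESucc (ren f a)
  | EPred a => EPred (ren f a)
  | EIter a b h => EIter (ren f a) (ren f b) (ren (scons 0 (succn \o f)) h)
  | EQry a => EQry (ren f a)
  end.

Lemma eval_ren W e f rho : eval W (ren f e) rho = eval W e (rho \o f).
Proof.
elim: e f rho => //= [a IHa|a IHa|a IHa b IHb h IHh|a IHa] f rho;
  rewrite ?IHa ?IHb //.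
by apply: eq_iter => x; rewrite IHh; congr eval; apply/funext; case.
Qed.

Definition elift := ren succn.

Lemma eval_lift W e x rho : eval W (elift e) (scons x rho) = eval W e rho.
Proof. by rewrite eval_ren; congr eval; apply/funext. Qed.

Definition econst n := iter n ESucc EZero.
Definition eadd a b := EIter b a (ESucc (EVar 0)).
Definition esub a b := EIter b a (EPred (EVar 0)).
Definition emul a b := EIter b EZero (eadd (EVar 0) (elift a)).
Definition enot a := esub (econst 1) a.
Definition eeq a b := enot (eadd (esub a b) (esub b a)).
Definition epair a b := eadd (emul (eadd a b) (eadd a b)) b.
Definition esqrt a := EIter a EZero
  (eadd (EVar 0) (enot (esub (emul (ESucc (EVar 0)) (ESucc (EVar 0))) (elift a)))).
Definition esnd a := esub a (emul (esqrt a) (esqrt a)).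
Definition efst a := esub (esqrt a) (esnd a).

Definition nsqrt n := iter n (fun s => s + (s.+1 * s.+1 <= n)) 0.
(** The value lies between the squares of [a + b] and [(a + b).+1], so an integer square root
    suffices for decoding. *)
Definition npair a b := (a + b) * (a + b) + b.
Definition nsnd n := n - nsqrt n * nsqrt n.
Definition nfst n := nsqrt n - nsnd n.

Lemma nsqrtP n : nsqrt n * nsqrt n <= n < (nsqrt n).+1 * (nsqrt n).+1.
Proof.
(* A round raises [s] as long as the next square is at most [n]: after [k] rounds, [s] is [k] or has
   stopped at the root. *)
suff h k : let s := iter k (fun s => s + (s.+1 * s.+1 <= n)) 0 in
    s * s <= n /\ (s = k \/ n < s.+1 * s.+1).
  have [le_s] := h n; rewrite -/(nsqrt n) in le_s *.
  by case=> e; nia.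
elim: k => [|k [IH1 IH2]] /=; first by split; [|left].
move: (iter _ _ _) IH1 IH2 => s IH1 IH2.
case: (leqP (s.+1 * s.+1) n) => h; rewrite ?addn1 ?addn0; split=> //; last by right.
by left; case: IH2 => ?; lia.
Qed.

Lemma nsqrt_pair a b : nsqrt (npair a b) = a + b.
Proof. by have := nsqrtP (npair a b); rewrite /npair; nia. Qed.

Lemma nsnd_pair a b : nsnd (npair a b) = b.
Proof. by rewrite /nsnd nsqrt_pair /npair addKn. Qed.

Lemma nfst_pair a b : nfst (npair a b) = a.
Proof. by rewrite /nfst nsnd_pair nsqrt_pair addnK. Qed.

Lemma eval_const W n rho : eval W (econst n) rho = n.
Proof. by elim: n => //= n ->. Qed.

Lemma eval_add W a b rho : eval W (eadd a b) rho = eval W a rho + eval W b rho.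
Proof. by rewrite /=; elim: (eval W b rho) => [|n /= ->]; rewrite ?addn0 ?addnS. Qed.

Lemma eval_sub W a b rho : eval W (esub a b) rho = eval W a rho - eval W b rho.
Proof. by rewrite /=; elim: (eval W b rho) => [|n /= ->]; rewrite ?subn0 ?subnS. Qed.

Lemma eval_mul W a b rho : eval W (emul a b) rho = eval W a rho * eval W b rho.
Proof.
rewrite [LHS]/=; elim: (eval W b rho) => [|n IHn]; first by rewrite muln0.
by rewrite iterS IHn -[X in X = _]/(eval W (eadd (EVar 0) (elift a)) _)
  eval_add eval_lift mulnS addnC.
Qed.

Lemma eval_not W a rho : eval W (enot a) rho = (eval W a rho == 0).
Proof. by rewrite eval_sub /=; case: (eval W a rho). Qed.

Lemma eval_eq W a b rho : eval W (eeq a b) rho = (eval W a rho == eval W b rho).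
Proof. by rewrite eval_not eval_add !eval_sub addn_eq0 !subn_eq0 -eqn_leq. Qed.

Lemma eval_pair W a b rho :
  eval W (epair a b) rho = npair (eval W a rho) (eval W b rho).
Proof. by rewrite !(eval_add, eval_mul). Qed.

Lemma eval_sqrt W a rho : eval W (esqrt a) rho = nsqrt (eval W a rho).
Proof.
rewrite /esqrt; set h := eadd _ _.
rewrite -[LHS]/(iter (eval W a rho) (fun s => eval W h (scons s rho)) 0).
apply: eq_iter => s; rewrite /h eval_add eval_not eval_sub eval_mul eval_lift.
by rewrite subn_eq0.
Qed.

Lemma eval_snd W a rho : eval W (esnd a) rho = nsnd (eval W a rho).
Proof. by rewrite eval_sub eval_mul eval_sqrt. Qed.

Lemma eval_fst W a rho : eval W (efst a) rho = nfst (eval W a rho).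
Proof. by rewrite eval_sub eval_snd eval_sqrt. Qed.

(** * Structured register programs and the compilation of expressions *)

Definition upd (s : nat -> nat) r x : nat -> nat :=
  fun i => if i == r then x else s i.

Inductive com :=
| CInc of nat
| CDec of nat
| CClr of nat
| CSeq of com & com
| CLoop of nat & com
| CQry of nat & com.

Fixpoint exec (W : pred nat) (c : com) (s : nat -> nat) : nat -> nat :=
  match c with
  | CInc r => upd s r (s r).+1
  | CDec r => upd s r (s r).-1
  | CClr r => upd s r 0
  | CSeq c1 c2 => exec W c2 (exec W c1 s)
  | CLoop r c => iter (s r) (fun s => exec W c (upd s r (s r).-1)) s
  | CQry r c => if W (s r) then exec W c s else s
  end.

Lemma exec_seq W c1 c2 s : exec W (CSeq c1 c2) s = exec W c2 (exec W c1 s).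
Proof. by []. Qed.

Lemma exec_loop W r c s :
  exec W (CLoop r c) s = iter (s r) (fun s => exec W c (upd s r (s r).-1)) s.
Proof. by []. Qed.

(* [exec] gives the value of the machine code of a loop only when the body
   leaves the loop counter alone. *)
Fixpoint loop_wf (c : com) : Prop :=
  match c with
  | CSeq c1 c2 => loop_wf c1 /\ loop_wf c2
  | CLoop r c => loop_wf c /\ forall W s, exec W c s r = s r
  | CQry _ c => loop_wf c
  | _ => True
  end.

Definition move r d := CSeq (CClr d) (CLoop r (CInc d)).

(** A loop reads a register by emptying it, so [r] is drained into two registers and restored from
    the second one. *)
Definition copy r d := CSeq (CSeq (CClr d) (CClr d.+1))
  (CSeq (CLoop r (CSeq (CInc d) (CInc d.+1))) (CLoop d.+1 (CInc r))).

(** Registers below [d] are live, [d] receives the result and those above are scratch. An iteration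
    has its accumulator in [d], its counter in [d.+1], and its body works from [d.+2] on. *)
Fixpoint compile (e : exp) (mu : nat -> nat) (d : nat) : com :=
  match e with
  | EVar i => copy (mu i) d
  | EZero => CClr d
  | ESucc a => CSeq (compile a mu d) (CInc d)
  | EPred a => CSeq (compile a mu d) (CDec d)
  | EIter a b h =>
      CSeq (compile b mu d) (CSeq (compile a mu d.+1)
        (CLoop d.+1 (CSeq (compile h (scons d mu) d.+2) (move d.+2 d))))
  | EQry a => CSeq (compile a mu d.+1) (CSeq (CClr d) (CQry d.+1 (CInc d)))
  end.

Lemma exec_loop_inc W (r d : nat) s : r != d ->
  exec W (CLoop r (CInc d)) s = upd (upd s r 0) d (s d + s r).
Proof.
move=> rd /=; move e: (s r) => n; elim: n s e => [|n IHn] s e.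
  apply/funext => i; rewrite /upd /=; case: eqP => [->|_]; first by rewrite addn0.
  by case: eqP => [->|].
rewrite iterSr IHn /upd ?eqxx ?(negPf rd) ?e // eq_sym (negPf rd).
apply/funext => i; case: eqP => // _; first by rewrite addSnnS.
by case: eqP.
Qed.

Lemma exec_move W (r d : nat) s : r != d ->
  exec W (move r d) s = upd (upd s r 0) d (s r).
Proof.
move=> rd; rewrite /move /= -/(exec W (CLoop r (CInc d)) _) exec_loop_inc //.
by apply/funext => i; rewrite /upd eqxx (negPf rd) /=; case: eqP => // /eqP /negPf ->.
Qed.

Lemma exec_copy W r d s : r < d ->
  exec W (copy r d) s = upd (upd s d (s r)) d.+1 0.
Proof.
move=> rd; rewrite /copy.
have loop s0 : exec W (CLoop r (CSeq (CInc d) (CInc d.+1))) s0 =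
    upd (upd (upd s0 r 0) d (s0 d + s0 r)) d.+1 (s0 d.+1 + s0 r).
  rewrite /=; move e: (s0 r) => n; elim: n s0 e => [|n IHn] s0 e.
    by apply/funext => i; rewrite /upd /=; do ![case: eqP => [->|_]]; rewrite ?addn0.
  rewrite iterSr IHn; last by rewrite /upd; do ![case: eqP => ? //=]; lia.
  by apply/funext => i; rewrite /upd /=; do ![case: eqP => ? //=]; subst; lia.
rewrite -[LHS]/(exec W (CLoop d.+1 (CInc r)) (exec W (CLoop r (CSeq (CInc d) (CInc d.+1)))
  (exec W (CSeq (CClr d) (CClr d.+1)) s))).
rewrite loop exec_loop_inc; last by lia.
apply/funext => i; rewrite /= /upd; do ![case: eqP => ? //=]; subst;
  by do ?lia; do ![case: eqP => ? //=]; lia.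
Qed.

Lemma compileP W e mu d s : (forall i, mu i < d) ->
  exec W (compile e mu d) s d = eval W e (s \o mu) /\
  forall r, r < d -> exec W (compile e mu d) s r = s r.
Proof.
elim: e mu d s => [i||a IHa|a IHa|a IHa b IHb h IHh|a IHa] mu d s mud.
- rewrite [compile _ _ _]/= exec_copy // /upd eqxx.
  split=> [|r rd]; first by rewrite ifN //; lia.
  by rewrite !ifN //; lia.
- by split=> [|r rd] /=; rewrite /upd ?eqxx // ifN //; lia.
- have [h1 h2] := IHa mu d s mud.
  split=> [|r rd] /=; rewrite /upd ?eqxx ?h1 // ifN ?h2 //; lia.
- have [h1 h2] := IHa mu d s mud.
  split=> [|r rd] /=; rewrite /upd ?eqxx ?h1 // ifN ?h2 //; lia.
- have [b1 b2] := IHb mu d s mud.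
  have mud1 i : mu i < d.+1 by have := mud i; lia.
  rewrite [compile _ _ _]/= !exec_seq exec_loop.
  set s1 := exec W (compile b mu d) s in b1 b2 *.
  have [a1 a2] := IHa mu d.+1 s1 mud1.
  set s2 := exec W (compile a mu d.+1) s1 in a1 a2 *.
  have es1 : s1 \o mu = s \o mu by apply/funext => i /=; apply: b2.
  rewrite a1 es1 [eval W (EIter _ _ _) _]/=.
  have : s2 d = eval W b (s \o mu) by rewrite a2 // b1.
  have : forall r, r < d -> s2 r = s r by move=> r rd; rewrite a2 ?b2 //; lia.
  move: (eval W a _) => n {a1 a2}; move: s2 => t.
  elim: n => [|n IHn] td tb; first by [].
  have [{}IHn1 {}IHn2] := IHn td tb; rewrite !iterS.
  set u := iter n _ _ in IHn1 IHn2 *.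
  have mud2 i : scons d mu i < d.+2 by case: i => //= i; have := mud i; lia.
  rewrite exec_seq; have [h1 h2] := IHh _ d.+2 (upd u d.+1 (u d.+1).-1) mud2.
  set u' := exec W (compile h _ _) _ in h1 h2 *.
  rewrite exec_move ?/upd ?eqxx; last lia.
  split=> [|r rd].
    rewrite h1 -IHn1; congr eval; apply/funext => -[|i] /=; rewrite /upd.
      by case: eqP => //; lia.
    by have := mud i => ?; case: eqP => [|_]; [lia|exact: IHn2].
  by rewrite !ifN ?h2 /upd ?ifN ?IHn2 //; lia.
- have mud1 i : mu i < d.+1 by have := mud i; lia.
  rewrite [compile _ _ _]/= [exec _ _ _]/=.
  have [a1 a2] := IHa mu d.+1 s mud1.
  set s1 := exec W _ s in a1 a2 *.
  have -> : upd s1 d 0 d.+1 = eval W a (s \o mu) by rewrite -a1 /upd; case: eqP; lia.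
  split=> [|r rd] /=; case: (W _); rewrite /upd ?eqxx //.
    by case: eqP => [|_]; [lia|apply: a2; lia].
  by case: eqP => [|_]; [lia|apply: a2; lia].
Qed.

Lemma compile_wf e mu d : (forall i, mu i < d) -> loop_wf (compile e mu d).
Proof.
elim: e mu d => [i||a IHa|a IHa|a IHa b IHb h IHh|a IHa] mu d mud //=.
- have := mud i => ?; split=> //; split; split=> //.
    by move=> W s; rewrite /upd; do ![case: eqP; first lia].
  by move=> W s; rewrite /upd; case: eqP => //; lia.
- by split => //; apply: IHa.
- by split => //; apply: IHa.
- have mud1 i : mu i < d.+1 by have := mud i; lia.
  have mud2 i : scons d mu i < d.+2 by case: i => //= i; have := mud i; lia.
  split; first exact: IHb.
  split; first exact: IHa.
  split; first by split; [exact: IHh|split=> //; split=> // W s; rewrite /upd; case: eqP => //; lia].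
  move=> W s; rewrite -[LHS]/(exec W (move d.+2 d) (exec W (compile h (scons d mu) d.+2) s) d.+1).
  rewrite exec_move; last lia.
  rewrite /upd !ifN; do ?lia.
  by have [_ ->] := compileP W h s mud2.
- by do !split; apply: IHa => i; have := mud i; lia.
Qed.

(** * Machine instructions and their simulation of programs *)

Inductive instr :=
| IInc of nat & nat
| IDec of nat & nat & nat
| IQry of nat & nat & nat
| IInit.

Definition config := (nat * (nat -> nat))%type.

Definition step (W : pred nat) (P : seq instr) (c : config) : config :=
  let: (q, s) := c in
  match nth IInit P q with
  | IInc r q1 => (q1, upd s r (s r).+1)
  | IDec r q1 q0 => (if s r == 0 then q0 else q1, upd s r (s r).-1)
  | IQry r q1 q0 => (if W (s r) then q1 else q0, s)
  | IInit => c
  end.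

Lemma stepE W P q s : step W P (q, s) =
  match nth IInit P q with
  | IInc r q1 => (q1, upd s r (s r).+1)
  | IDec r q1 q0 => (if s r == 0 then q0 else q1, upd s r (s r).-1)
  | IQry r q1 q0 => (if W (s r) then q1 else q0, s)
  | IInit => (q, s)
  end.
Proof. by []. Qed.

Fixpoint csize (c : com) : nat :=
  match c with
  | CInc _ | CDec _ | CClr _ => 1
  | CSeq c1 c2 => csize c1 + csize c2
  | CLoop _ c => (csize c).+1
  | CQry _ c => (csize c).+1
  end.

(* Code placed at the address [p], which leaves to the address [k]. *)
Fixpoint code (c : com) (p k : nat) : seq instr :=
  match c with
  | CInc r => [:: IInc r k]
  | CDec r => [:: IDec r k k]
  | CClr r => [:: IDec r p k]
  | CSeq c1 c2 => code c1 p (p + csize c1) ++ code c2 (p + csize c1) k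
  | CLoop r c => IDec r p.+1 k :: code c p.+1 p
  | CQry r c => IQry r p.+1 k :: code c p.+1 k
  end.

Lemma size_code c p k : size (code c p k) = csize c.
Proof.
by elim: c p k => //= [c1 IH1 c2 IH2|r c IH|r c IH] p k;
  rewrite ?size_cat ?IH1 ?IH2 ?IH.
Qed.

Lemma csize_gt0 c : 0 < csize c.
Proof. by elim: c => //= c1 h1 c2 h2; lia. Qed.

Definition code_at (P : seq instr) (l : seq instr) p :=
  forall i, i < size l -> nth IInit P (p + i) = nth IInit l i.

Lemma code_at_cat P l1 l2 p : code_at P (l1 ++ l2) p ->
  code_at P l1 p /\ code_at P l2 (p + size l1).
Proof.
move=> h; split=> i il; [have := h i|have := h (size l1 + i)]; rewrite nth_cat size_cat.
  by rewrite il; apply; lia.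
by rewrite -addnA => ->; [rewrite ifN ?addKn //; lia|lia].
Qed.

Lemma code_at_cons P a l p : code_at P (a :: l) p ->
  nth IInit P p = a /\ code_at P l p.+1.
Proof.
move=> h; split=> [|i il]; first by have := h 0; rewrite addn0; apply.
by have := h i.+1; rewrite addnS -addSn; apply.
Qed.

(** The address range is recorded because [recurrentP] counts the visits to an address outside the
    compiled body. *)
Definition reach W P p p' (c c' : config) :=
  exists2 t, iter t (step W P) c = c' &
    forall i, i < t -> p <= (iter i (step W P) c).1 < p'.

Lemma reach_refl W P p p' c : reach W P p p' c c.
Proof. by exists 0. Qed.

Lemma reach_trans W P p p' c1 c2 c3 :
  reach W P p p' c1 c2 -> reach W P p p' c2 c3 -> reach W P p p' c1 c3.
Proof.
move=> [t1 e1 h1] [t2 e2 h2]; exists (t2 + t1); first by rewrite iterD e1.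
move=> i it; case: (ltnP i t1) => [/h1 //|le_t1].
by rewrite -(subnK le_t1) iterD e1; apply: h2; lia.
Qed.

Lemma reach_step W P p p' c : p <= c.1 < p' -> reach W P p p' c (step W P c).
Proof. by move=> h; exists 1 => // -[]. Qed.

Lemma reachS W P p1 p1' p2 p2' c c' : p2 <= p1 -> p1' <= p2' ->
  reach W P p1 p1' c c' -> reach W P p2 p2' c c'.
Proof.
by move=> h1 h2 [t et ht]; exists t => // i /ht/andP[]; lia.
Qed.

Lemma codeP W P c p k s : loop_wf c -> code_at P (code c p k) p ->
  reach W P p (p + csize c) (p, s) (k, exec W c s).
Proof.
elim: c p k s => [r|r|r|c1 IH1 c2 IH2|r c IH|r c IH] p k s /=.
- move=> _ /code_at_cons[e _].
  have := @reach_step W P p (p + 1) (p, s); rewrite /= e; apply; lia.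
- move=> _ /code_at_cons[e _].
  have := @reach_step W P p (p + 1) (p, s); rewrite /= e if_same; apply; lia.
- move=> _ /code_at_cons[e _].
  move es: (s r) => n; elim: n s es => [|n IHn] s es.
    have := @reach_step W P p (p + 1) (p, s); rewrite /= e es /=; apply; lia.
  apply: (@reach_trans _ _ _ _ _ (p, upd s r n)).
    have := @reach_step W P p (p + 1) (p, s); rewrite /= e es /=; apply; lia.
  have -> : upd s r 0 = upd (upd s r n) r 0 by apply/funext => i; rewrite /upd; case: eqP.
  by apply: IHn; rewrite /upd eqxx.
- move=> [wf1 wf2] /code_at_cat[h1]; rewrite size_code => h2.
  apply: reach_trans.
    by apply: reachS (IH1 _ _ s wf1 h1) => //; lia.
  by apply: reachS (IH2 _ _ _ wf2 h2) => //; lia.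
- move=> [wf cr] /code_at_cons[e h].
  move es: (s r) => n; elim: n s es => [|n IHn] s es.
    have -> : iter 0 (fun s0 => exec W c (upd s0 r (s0 r).-1)) s = upd s r (s r).-1.
      by apply/funext => i; rewrite /upd /=; case: eqP => // ->; rewrite es.
    have := @reach_step W P p (p + (csize c).+1) (p, s); rewrite /= e es /=; apply; lia.
  apply: (@reach_trans _ _ _ _ _ (p.+1, upd s r (s r).-1)).
    have := @reach_step W P p (p + (csize c).+1) (p, s); rewrite /= e es /=; apply; lia.
  apply: reach_trans; first by apply: reachS (IH _ _ _ wf h); lia.
  by rewrite iterSr; apply: IHn; rewrite cr /upd eqxx es.
- move=> wf /code_at_cons[e h].
  apply: (@reach_trans _ _ _ _ _ (if W (s r) then p.+1 else k, s)).
    have := @reach_step W P p (p + (csize c).+1) (p, s); rewrite /= e; apply; lia.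
  case: ifP => _; last exact: reach_refl.
  by apply: reachS (IH _ _ _ wf h); lia.
Qed.

Definition targets (i : instr) : seq nat :=
  match i with
  | IInc _ q => [:: q]
  | IDec _ q1 q0 | IQry _ q1 q0 => [:: q1; q0]
  | IInit => [::]
  end.

(** Nonemptiness rules out [IInit], the only instruction without target. *)
Definition targets_in (P : pred nat) (i : instr) :=
  (targets i != [::]) && all P (targets i).

Lemma sub_targets_in (P Q : pred nat) : subpred P Q -> subpred (targets_in P) (targets_in Q).
Proof. by move=> PQ i /andP[ni /(sub_all PQ) hi]; apply/andP. Qed.

Lemma code_targets c p k :
  all (targets_in (fun q => (q == k) || (p <= q < p + csize c))) (code c p k).
Proof.
elim: c p k => /= [r|r|r|c1 IH1 c2 IH2|r c IH|r c IH] p k;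
  rewrite /targets_in ?eqxx ?orbT /= ?andbT //; do ?lia.
- have g1 := csize_gt0 c1; have g2 := csize_gt0 c2; rewrite all_cat; apply/andP; split.
    by apply: sub_all (IH1 p (p + csize c1)); apply: sub_targets_in => q; lia.
  by apply: sub_all (IH2 (p + csize c1) k); apply: sub_targets_in => q; lia.
- have g := csize_gt0 c; apply/andP; split; first lia.
  by apply: sub_all (IH p.+1 p); apply: sub_targets_in => q; lia.
- have g := csize_gt0 c; apply/andP; split; first lia.
  by apply: sub_all (IH p.+1 k); apply: sub_targets_in => q; lia.
Qed.

(** * Arithmetical truth relative to an oracle *)

Fixpoint term_code (t : term) : nat :=
  match t with
  | TVar i => CodeSeq.code [:: 0; i]
  | TZero => CodeSeq.code [:: 1]
  | TSucc t => CodeSeq.code [:: 2; term_code t]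
  | TAdd t u => CodeSeq.code [:: 3; term_code t; term_code u]
  | TMul t u => CodeSeq.code [:: 4; term_code t; term_code u]
  end.

Lemma term_code_inj : injective term_code.
Proof.
elim=> [i||t IHt|t IHt u IHu|t IHt u IHu] [j||t'|t' u'|t' u'] //.
all: move=> /code_inj e; case: e => //.
- by move=> ->.
- by move=> /IHt ->.
- by move=> /IHt -> /IHu ->.
- by move=> /IHt -> /IHu ->.
Qed.

Fixpoint form_code (p : form) : nat :=
  match p with
  | FEq t u => CodeSeq.code [:: 0; term_code t; term_code u]
  | FLt t u => CodeSeq.code [:: 1; term_code t; term_code u]
  | FMem t i => CodeSeq.code [:: 2; term_code t; i]
  | FNot p => CodeSeq.code [:: 3; form_code p]
  | FAnd p q => CodeSeq.code [:: 4; form_code p; form_code q]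
  | FOr p q => CodeSeq.code [:: 5; form_code p; form_code q]
  | FImp p q => CodeSeq.code [:: 6; form_code p; form_code q]
  | FAll p => CodeSeq.code [:: 7; form_code p]
  | FEx p => CodeSeq.code [:: 8; form_code p]
  | FAllSet p => CodeSeq.code [:: 9; form_code p]
  | FExSet p => CodeSeq.code [:: 10; form_code p]
  end.

Lemma form_code_inj : injective form_code.
Proof.
elim=> [t u|t u|t i|p IHp|p IHp q IHq|p IHp q IHq|p IHp q IHq|p IHp|p IHp|p IHp|p IHp]
  [t' u'|t' u'|t' i'|p'|p' q'|p' q'|p' q'|p'|p'|p'|p'] //.
all: move=> /code_inj e; case: e => //.
- by move=> /term_code_inj -> /term_code_inj ->.
- by move=> /term_code_inj -> /term_code_inj ->.
- by move=> /term_code_inj -> ->.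
- by move=> /IHp ->.
- by move=> /IHp -> /IHq ->.
- by move=> /IHp -> /IHq ->.
- by move=> /IHp -> /IHq ->.
- by move=> /IHp ->.
- by move=> /IHp ->.
- by move=> /IHp ->.
- by move=> /IHp ->.
Qed.

HB.instance Definition _ := Equality.copy form (inj_type form_code_inj).

(* The number [c] codes the environment [nfst c, nfst (nsnd c), ...]. *)
Definition env (c i : nat) : nat := nfst (iter i nsnd c).

Lemma env_pair x c : env (npair x c) = scons x (env c).
Proof.
apply/funext => -[|i]; rewrite /env /=; first by rewrite nfst_pair.
by rewrite -iterS iterSr nsnd_pair.
Qed.

Lemma env0 : env 0 = fun=> 0.
Proof. by apply/funext => i; rewrite /env; elim: i => // i; rewrite iterSr. Qed.

(* An oracle [W] stores the values of the set variables and, for every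
   quantified formula, the codes of the environments satisfying it. *)
Definition oracle_set (W : pred nat) (j : nat) : set nat :=
  [set x | W (npair 0 (npair j x))].

Definition oracle_form (W : pred nat) (p : form) (c : nat) : bool :=
  W (npair (form_code p).+1 c).

(** Quantified subformulas are looked up in the oracle instead of being unfolded, so finitely many
    queries suffice; [clause] ties the table to actual truth. *)
Fixpoint qholds (W : pred nat) (c : nat) (p : form) : Prop :=
  match p with
  | FEq t u => teval (env c) t = teval (env c) u
  | FLt t u => teval (env c) t < teval (env c) u
  | FMem t j => oracle_set W j (teval (env c) t)
  | FNot p => ~ qholds W c p
  | FAnd p q => qholds W c p /\ qholds W c q
  | FOr p q => qholds W c p \/ qholds W c q
  | FImp p q => qholds W c p -> qholds W c q
  | _ => oracle_form W p c
  end.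

Fixpoint qsubs (p : form) : seq form :=
  match p with
  | FNot p => qsubs p
  | FAnd p q | FOr p q | FImp p q => qsubs p ++ qsubs q
  | FAll q | FEx q => p :: qsubs q
  | _ => [::]
  end.

(* Tarski's clause for the quantified formula [p] at the environment [c];
   its existential part is witnessed by [y], its universal part is tested on
   [z]. *)
Definition clause (W : pred nat) (p : form) (c z y : nat) : Prop :=
  match p with
  | FEx q => (oracle_form W p c -> qholds W (npair y c) q) /\
             (qholds W (npair z c) q -> oracle_form W p c)
  | FAll q => (oracle_form W p c -> qholds W (npair z c) q) /\
              (qholds W (npair y c) q -> oracle_form W p c)
  | _ => True
  end.

Lemma qholds_sound W p : arithmetical p ->
  (forall q, q \in qsubs p -> forall c z, exists y, clause W q c z y) ->
  forall c, qholds W c p <-> holds (env c) (oracle_set W) p.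
Proof.
elim: p => //= [p IHp|p IHp q IHq|p IHp q IHq|p IHp q IHq|p IHp|p IHp].
- by move=> ap h c; have := IHp ap h c; tauto.
- move=> /andP[ap aq] h c.
  have := IHp ap (fun r hr => h r ltac:(by rewrite mem_cat hr)) c.
  by have := IHq aq (fun r hr => h r ltac:(by rewrite mem_cat hr orbT)) c; tauto.
- move=> /andP[ap aq] h c.
  have := IHp ap (fun r hr => h r ltac:(by rewrite mem_cat hr)) c.
  by have := IHq aq (fun r hr => h r ltac:(by rewrite mem_cat hr orbT)) c; tauto.
- move=> /andP[ap aq] h c.
  have := IHp ap (fun r hr => h r ltac:(by rewrite mem_cat hr)) c.
  by have := IHq aq (fun r hr => h r ltac:(by rewrite mem_cat hr orbT)) c; tauto.
- move=> ap h c; have IH := IHp ap (fun r hr => h r ltac:(by rewrite in_cons hr orbT)).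
  have cl := h _ (mem_head _ _); split=> [Wc n|hp].
    by rewrite -env_pair -IH; have [y [/(_ Wc)]] := cl c n.
  by have [y [_]] := cl c 0; apply; rewrite IH env_pair.
- move=> ap h c; have IH := IHp ap (fun r hr => h r ltac:(by rewrite in_cons hr orbT)).
  have cl := h _ (mem_head _ _); split=> [Wc|[n hn]].
    have [y [/(_ Wc) hy _]] := cl c 0.
    by exists y; rewrite -env_pair -IH.
  by have [y [_]] := cl c n; apply; rewrite IH env_pair.
Qed.

Definition truth_oracle (E : nat -> set nat) : pred nat := fun z =>
  `[< nfst z = 0 /\ E (nfst (nsnd z)) (nsnd (nsnd z)) \/
      exists2 p, nfst z = (form_code p).+1 & holds (env (nsnd z)) E p >].

Lemma oracle_set_truth E : oracle_set (truth_oracle E) = E.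
Proof.
apply/funext => j; apply/funext => x; apply/propext.
rewrite /oracle_set /truth_oracle /=; split=> [/asboolP|Ex]; last apply/asboolP;
  rewrite !nfst_pair !nsnd_pair ?nfst_pair.
  by case=> [[]|[p]].
by left.
Qed.

Lemma oracle_form_truth E p c :
  oracle_form (truth_oracle E) p c <-> holds (env c) E p.
Proof.
rewrite /oracle_form /truth_oracle; split=> [/asboolP|hp]; last apply/asboolP;
  rewrite !nfst_pair !nsnd_pair.
  by case=> [[]|[q [/form_code_inj ->]]].
by right; exists p.
Qed.

Lemma qholds_truth E p c : arithmetical p ->
  qholds (truth_oracle E) c p <-> holds (env c) E p.
Proof.
elim: p => //= [t j|p IHp|p IHp q IHq|p IHp q IHq|p IHp q IHq|p IHp|p IHp].
- by rewrite oracle_set_truth.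
- by move=> /IHp; tauto.
- by move=> /andP[/IHp hp /IHq hq]; tauto.
- by move=> /andP[/IHp hp /IHq hq]; tauto.
- by move=> /andP[/IHp hp /IHq hq]; tauto.
- by rewrite oracle_form_truth.
- by rewrite oracle_form_truth.
Qed.

Lemma qsubs_arithmetical p q : arithmetical p -> q \in qsubs p -> arithmetical q.
Proof.
elim: p => //= [p IHp r IHr|p IHp r IHr|p IHp r IHr|p IHp|p IHp].
- by move=> /andP[/IHp hp /IHr hr]; rewrite mem_cat => /orP[].
- by move=> /andP[/IHp hp /IHr hr]; rewrite mem_cat => /orP[].
- by move=> /andP[/IHp hp /IHr hr]; rewrite mem_cat => /orP[].
- by move=> ap; rewrite in_cons => /orP[/eqP->|/(IHp ap)].
- by move=> ap; rewrite in_cons => /orP[/eqP->|/(IHp ap)].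
Qed.

(** The witness is a counterexample to a universal formula, or an instance of an existential one, as
    soon as there is any. *)
Lemma clause_truth E p c z : arithmetical p ->
  exists y, clause (truth_oracle E) p c z y.
Proof.
case: p => //=; do ?[by exists 0]; move=> p ap.
- have [[y hy]|no] := pselect (exists y, ~ holds (scons y (env c)) E p).
    exists y; rewrite oracle_form_truth !qholds_truth // !env_pair.
    by split=> // h; apply: h.
  exists 0; rewrite oracle_form_truth !qholds_truth // !env_pair; split=> [h|_ n].
    exact: h.
  by apply: contrapT => hn; apply: no; exists n.
- have [[y hy]|no] := pselect (exists y, holds (scons y (env c)) E p).
    exists y; rewrite oracle_form_truth !qholds_truth // !env_pair.
    by split=> // h; exists z.
  exists 0; rewrite oracle_form_truth !qholds_truth // !env_pair.
  by split=> // h; exists z.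
Qed.

(** * Evaluation of formulas by expressions *)

Fixpoint texp (t : term) (c : exp) : exp :=
  match t with
  | TVar i => efst (iter i esnd c)
  | TZero => EZero
  | TSucc t => ESucc (texp t c)
  | TAdd t u => eadd (texp t c) (texp u c)
  | TMul t u => emul (texp t c) (texp u c)
  end.

Lemma eval_texp W t c rho :
  eval W (texp t c) rho = teval (env (eval W c rho)) t.
Proof.
elim: t => [i||t IHt|t IHt u IHu|t IHt u IHu].
- rewrite eval_fst /env [teval _ _]/=; congr nfst.
  by elim: i => [//|i IHi]; rewrite !iterS eval_snd IHi.
- by [].
- by rewrite /= IHt.
- by rewrite eval_add IHt IHu.
- by rewrite eval_mul IHt IHu.
Qed.

Definition eoracle_form (p : form) (c : exp) : exp :=
  EQry (epair (econst (form_code p).+1) c).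

(** Truth is positivity of the value: sum and product then serve as disjunction and conjunction, and
    truncated subtraction as strict comparison. *)
Fixpoint fexp (p : form) (c : exp) : exp :=
  match p with
  | FEq t u => eeq (texp t c) (texp u c)
  | FLt t u => esub (texp u c) (texp t c)
  | FMem t j => EQry (epair EZero (epair (econst j) (texp t c)))
  | FNot p => enot (fexp p c)
  | FAnd p q => emul (fexp p c) (fexp q c)
  | FOr p q => eadd (fexp p c) (fexp q c)
  | FImp p q => eadd (enot (fexp p c)) (fexp q c)
  | _ => eoracle_form p c
  end.

Lemma eval_oracle_form W p c rho :
  eval W (eoracle_form p c) rho = oracle_form W p (eval W c rho).
Proof.
by rewrite /oracle_form -[in RHS](eval_const W (form_code p).+1 rho) -eval_pair.
Qed.

Lemma eval_fexp W p c rho :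
  0 < eval W (fexp p c) rho <-> qholds W (eval W c rho) p.
Proof.
elim: p => [t u|t u|t j|p IHp|p IHp q IHq|p IHp q IHq|p IHp q IHq|p _|p _|p _|p _].
- by rewrite eval_eq !eval_texp /=; case: eqP.
- by rewrite eval_sub !eval_texp /= subn_gt0.
- rewrite [fexp _ _]/= eval_qry !eval_pair eval_const eval_texp.
  by rewrite [qholds _ _ _]/= /oracle_set /=; case: (W _).
- rewrite [fexp _ _]/= eval_not lt0b [qholds _ _ _]/= -IHp lt0n.
  by split=> [-> //|/negP]; rewrite negbK.
- by rewrite [fexp _ _]/= eval_mul [qholds _ _ _]/= -IHp -IHq muln_gt0; split=> /andP.
- by rewrite [fexp _ _]/= eval_add [qholds _ _ _]/= -IHp -IHq addn_gt0; split=> /orP.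
- rewrite [fexp _ _]/= eval_add eval_not [qholds _ _ _]/= -IHp -IHq addn_gt0.
  case: (eval W (fexp p c) rho) => [|m] /=; first by split=> // _ [].
  by split=> // h; apply: h.
all: by rewrite [fexp _ _]/= eval_oracle_form /=; case: oracle_form.
Qed.

Definition eimp a b := eadd (enot a) b.

Lemma eval_imp W a b rho : 0 < eval W (eimp a b) rho <->
  (0 < eval W a rho -> 0 < eval W b rho).
Proof.
rewrite eval_add eval_not; case: (eval W a rho) => [|m] /=; first by split.
by split=> // h; apply: h.
Qed.

Lemma eval_and W a b rho : 0 < eval W (emul a b) rho <->
  (0 < eval W a rho /\ 0 < eval W b rho).
Proof. by rewrite eval_mul muln_gt0; split=> /andP. Qed.

Definition eclause (p : form) (c z y : exp) : exp :=
  match p with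
  | FEx q => emul (eimp (eoracle_form p c) (fexp q (epair y c)))
                  (eimp (fexp q (epair z c)) (eoracle_form p c))
  | FAll q => emul (eimp (eoracle_form p c) (fexp q (epair z c)))
                   (eimp (fexp q (epair y c)) (eoracle_form p c))
  | _ => econst 1
  end.

Lemma eval_clause W p c z y rho : 0 < eval W (eclause p c z y) rho <->
  clause W p (eval W c rho) (eval W z rho) (eval W y rho).
Proof.
by case: p => // p; rewrite eval_and !eval_imp !eval_oracle_form !eval_fexp !eval_pair /=;
  case: oracle_form.
Qed.

Definition eclauses (s : seq form) (i c z y : exp) : exp :=
  foldr (fun p => emul (eimp (eeq i (econst (form_code p))) (eclause p c z y)))
    (econst 1) s.

Lemma eval_clauses W s i c z y rho : 0 < eval W (eclauses s i c z y) rho <->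
  forall p, p \in s -> eval W i rho = form_code p ->
    clause W p (eval W c rho) (eval W z rho) (eval W y rho).
Proof.
elim: s => [|p s IHs]; first by split.
rewrite [eclauses _ _ _ _ _]/= eval_and IHs eval_imp eval_eq eval_const eval_clause.
rewrite lt0b; split=> [[h1 h2] q|h].
  by rewrite in_cons => /orP[/eqP-> /eqP/h1|/h2].
split=> [/eqP|q qs]; first exact/h/mem_head.
by apply: h; rewrite in_cons qs orbT.
Qed.

(* Variables: 0 is the instance, 1 the code [npair i (npair c z)] of the
   clause [i] at [c] and [z], and 2 the witness [y]. *)
Definition checker (p : form) : exp :=
  let m := EVar 1 in
  emul (enot (fexp p (epair (EVar 0) EZero)))
    (eclauses (qsubs p) (efst m) (efst (esnd m)) (esnd (esnd m)) (EVar 2)).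

Definition checks W p n m y :=
  [/\ ~ qholds W (npair n 0) p &
      forall q, q \in qsubs p -> nfst m = form_code q ->
        clause W q (nfst (nsnd m)) (nsnd (nsnd m)) y].

Lemma eval_checker W p rho :
  0 < eval W (checker p) rho <-> checks W p (rho 0) (rho 1) (rho 2).
Proof.
rewrite eval_and eval_clauses !(eval_fst, eval_snd) eval_not lt0b.
have := eval_fexp W p (epair (EVar 0) EZero) rho; rewrite eval_pair /= => hp.
split=> [[h1 h2]|[h1 h2]]; split=> //.
  by rewrite -hp lt0n h1.
by move: h1; rewrite -hp lt0n => /negP; rewrite negbK.
Qed.

Lemma checksP p n : arithmetical p ->
  (exists E, ~ holds (scons n (fun=> 0)) E p) <->
  exists W, forall m, exists y, checks W p n m y.
Proof.
move=> ap; have en : scons n (fun=> 0) = env (npair n 0) by rewrite env_pair env0.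
split=> [[E hE]|[W hW]].
  exists (truth_oracle E) => m.
  have nq : ~ qholds (truth_oracle E) (npair n 0) p by rewrite qholds_truth // -en.
  have [[q qp mq]|no] := pselect (exists2 q, q \in qsubs p & nfst m = form_code q).
    have [y hy] := clause_truth E (nfst (nsnd m)) (nsnd (nsnd m)) (qsubs_arithmetical ap qp).
    by exists y; split=> // r rp; rewrite mq => /form_code_inj <-.
  (* Here [m] names no clause to be tested, so any [y] passes. *)
  by exists 0; split=> // q qp mq; case: no; exists q.
exists (oracle_set W); rewrite en -qholds_sound //; first by have [y []] := hW 0.
move=> q qp c z; have [y [_ /(_ q qp)]] := hW (npair (form_code q) (npair c z)).
by rewrite !(nfst_pair, nsnd_pair) => /(_ erefl) hy; exists y.
Qed.

(** A leading universal set quantifier is absorbed by the quantification over all [E]: its variable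
    is just one more entry of the environment. *)
Lemma pi11_arithmetical B : pi11 B -> exists2 p, arithmetical p &
  forall n, B n <-> forall E, holds (scons n (fun=> 0)) E p.
Proof.
move=> [phi hphi hB].
suff [p ap hp] : exists2 p, arithmetical p &
    forall e, (forall E, holds e E phi) <-> (forall E, holds e E p).
  exists p => // n; rewrite -hp; split=> [Bn E|h]; first by rewrite -hB.
  exact/(hB n (fun=> 0) (fun=> set0)).
elim: phi {hB} hphi => //; do ?[by move=> *; eexists; [eassumption|]].
move=> p IHp /IHp[q aq hq]; exists q => // e; rewrite -hq; split=> h E /=.
  have := h (E \o succn) (E 0); congr holds; apply/funext.
  by case.
by move=> X; apply: h.
Qed.

(** * The counter machine *)

Section Machine.
Variable e : exp.

Definition body := compile e (fun i => if i < 3 then i else 0) 3.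
Definition lbl := (csize body).+1.

(* Registers: 0 the instance, 1 and 2 the current pair [(m, y)], 3 the verdict
   of [body] on it. The address [lbl.+4] is the initial state, in which the
   register 0 is filled, up to [n.+1]; then the control moves to 0. The address
   [lbl.+2] is visited once for each [m] for which a [y] is found. *)
Definition program : seq instr :=
  IDec 0 1 1 :: code body 1 lbl ++
  [:: IDec 3 lbl.+2 lbl.+1; IInc 2 1; IInc 1 lbl.+3; IDec 2 lbl.+3 1; IInit].

Lemma size_program : size program = lbl.+4.+1.
Proof. by rewrite /= size_cat size_code addnC. Qed.

Lemma program_body : code_at program (code body 1 lbl) 1.
Proof.
by move=> i il; rewrite /program add1n /= nth_cat il.
Qed.

Lemma program_tail i : nth IInit program (lbl + i) =
  nth IInit [:: IDec 3 lbl.+2 lbl.+1; IInc 2 1; IInc 1 lbl.+3; IDec 2 lbl.+3 1; IInit] i.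
Proof.
by rewrite /program /= nth_cat size_code ltnNge leq_addr addKn.
Qed.

(** Once running, the machine never returns to the address 0 or to the initial label; this lets
    [cmark] and [canti] locate the end of the initial phase. *)
Lemma program_targets q : q < lbl.+4 ->
  targets_in (fun q => 0 < q < lbl.+4) (nth IInit program q).
Proof.
move=> ql; pose P := targets_in (fun q => 0 < q < lbl.+4).
have hP : all P (take lbl.+4 program).
  rewrite /= take_cat size_code ifN; last by rewrite /lbl; lia.
  have -> : lbl.+3 - csize body = 4 by rewrite /lbl; lia.
  rewrite all_cat /= !andbT /P /targets_in /=.
  rewrite !ltnS !leqnn !leqnSn !leqW // !andbT.
  apply: sub_all (code_targets body 1 lbl); apply: sub_targets_in => i.
  by rewrite /lbl; lia.
have := all_nthP IInit hP q; rewrite nth_take //; apply.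
by rewrite size_take size_program ltnSn.
Qed.

(** Register 0 counts the rows of the initial phase, hence holds [n.+1] when the program starts; the
    first instruction brings it down to [n]. The address 0 is thus visited at time [n.+1] only and
    can serve as a marker. *)
Definition conf (n : nat) (W : pred nat) (j : nat) : config :=
  if j <= n then (lbl.+4, upd (fun=> 0) 0 j)
  else iter (j - n.+1) (step W program) (0, upd (fun=> 0) 0 n.+1).

Lemma conf_init n W j : j <= n -> conf n W j = (lbl.+4, upd (fun=> 0) 0 j).
Proof. by rewrite /conf => ->. Qed.

Lemma conf_start n W : conf n W n.+1 = (0, upd (fun=> 0) 0 n.+1).
Proof. by rewrite /conf ltnn subnn. Qed.

Lemma conf_iter n W j i : n < j ->
  conf n W (j + i) = iter i (step W program) (conf n W j).
Proof.
move=> nj; rewrite /conf ifN; last lia.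
by rewrite ifN -?iterD; [congr iter|]; lia.
Qed.

Lemma conf_step n W j : n < j -> conf n W j.+1 = step W program (conf n W j).
Proof. by move=> nj; rewrite -addn1 conf_iter. Qed.

Lemma conf_label n W j : n.+1 < j -> 0 < (conf n W j).1 < lbl.+4.
Proof.
elim: j => // j IHj; rewrite ltnS leq_eqVlt => /orP[/eqP<-|nj].
  by rewrite conf_step // conf_start.
rewrite conf_step; last by lia.
have := IHj nj; case: (conf n W j) => q s /= /andP[q0 qK].
have := program_targets qK.
case: nth => [r q1|r q1 q2|r q1 q2|] //=; rewrite /targets_in /= ?andbT //.
- by case: ifP => _ /andP[].
- by case: ifP => _ /andP[].
Qed.

Lemma conf_label_lt n W j : (conf n W j).1 < lbl.+4.+1.
Proof.
have [jn|nj] := leqP j n; first by rewrite conf_init.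
have := @conf_label n W j; case: (ltnP n.+1 j) => h; first by move/(_ isT); lia.
by have -> : j = n.+1; [lia|rewrite conf_start].
Qed.

(** A register grows by at most 1 per time step. Thus the indices up to [j] of row [j] include every
    register value. *)
Lemma conf_reg n W j r : (conf n W j).2 r <= j.
Proof.
have [jn|nj] := leqP j n; first by rewrite conf_init //= /upd; case: eqP.
rewrite -(subnKC nj); elim: (j - n.+1) => [|i IHi].
  by rewrite addn0 conf_start /= /upd; case: eqP.
rewrite addnS conf_step; last lia.
move: IHi; case: (conf n W _) => q s /=.
by case: nth => [r0 q1|r0 q1 q2|r0 q1 q2|] /=; rewrite /upd; try case: eqP => [->|_]; lia.
Qed.

Variables (W : pred nat) (n : nat) (Q : nat -> nat -> Prop).
Hypothesis evalQ : forall rho, rho 0 = n ->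
  0 < eval W e rho <-> Q (rho 1) (rho 2).

Definition at_round m y t := n < t /\ exists s,
  [/\ conf n W t = (1, s), s 0 = n, s 1 = m & s 2 = y].

Lemma at_round0 : at_round 0 0 n.+2.
Proof.
split=> //; rewrite conf_step // conf_start /=.
by exists (upd (upd (fun=> 0) 0 n.+1) 0 n).
Qed.

Lemma at_round_verdict m y t : at_round m y t -> exists s t',
  [/\ t <= t', conf n W t' = (lbl, s), [/\ s 0 = n, s 1 = m & s 2 = y],
      (0 < s 3) <-> Q m y & forall i, t <= i < t' -> (conf n W i).1 < lbl].
Proof.
move=> [nt [s [ct s0 s1 s2]]].
have mu3 i : (if i < 3 then i else 0) < 3 by case: ifP.
have [v ev hv] := codeP W s (compile_wf e mu3) program_body.
have [hd hr] := compileP W e s mu3.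
exists (exec W body s), (t + v); split=> //.
- exact: leq_addr.
- by rewrite conf_iter // ct.
- by rewrite !hr.
- by rewrite hd evalQ /= ?s1 ?s2.
move=> i /andP[ti iv].
by rewrite -(subnKC ti) conf_iter // ct; have /andP[] := hv (i - t) ltac:(lia).
Qed.

Lemma at_round_fail m y t : at_round m y t -> ~ Q m y ->
  exists2 t', t < t' & at_round m y.+1 t' /\
    forall i, t <= i < t' -> (conf n W i).1 != lbl.+2.
Proof.
move=> ht nQ; have nt : n < t by case: ht.
have [s [t' [tt' ct' [s0 s1 s2] hs3 lt_lbl]]] := at_round_verdict ht.
have s3 : s 3 = 0 by case: (s 3) hs3 => // k [/(_ isT)/nQ].
have c1 : conf n W t'.+1 = (lbl.+1, upd s 3 0).
  rewrite conf_step ?ct' ?stepE; last lia.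
  by have := program_tail 0; rewrite addn0 => -> /=; rewrite s3.
have c2 : conf n W t'.+2 = (1, upd (upd s 3 0) 2 y.+1).
  rewrite conf_step ?c1 ?stepE; last lia.
  by have := program_tail 1; rewrite addn1 => -> /=; rewrite /upd /= s2.
exists t'.+2; first lia.
split; first by split; [lia|exists (upd (upd s 3 0) 2 y.+1)].
move=> i /andP[ti it'].
have [lt_t|] := ltnP i t'; first by have := lt_lbl i; rewrite ti lt_t => /(_ isT); lia.
rewrite leq_eqVlt => /orP[/eqP<-|le_t]; first by rewrite ct' /=; lia.
have -> : i = t'.+1 by lia.
by rewrite c1 /=; lia.
Qed.

Lemma at_round_ok m y t : at_round m y t -> Q m y -> exists t1 t',
  [/\ t <= t1 < t', (conf n W t1).1 = lbl.+2 & at_round m.+1 0 t'].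
Proof.
move=> ht hQ; have nt : n < t by case: ht.
have [s [t' [tt' ct' [s0 s1 s2] hs3 lt_lbl]]] := at_round_verdict ht.
have s3 : 0 < s 3 by apply/hs3.
have c1 : conf n W t'.+1 = (lbl.+2, upd s 3 (s 3).-1).
  rewrite conf_step ?ct' ?stepE; last lia.
  by have := program_tail 0; rewrite addn0 => -> /=; case: (s 3) s3.
have c2 : conf n W t'.+2 = (lbl.+3, upd (upd s 3 (s 3).-1) 1 m.+1).
  rewrite conf_step ?c1 ?stepE; last lia.
  by have := program_tail 2; rewrite addn2 => -> /=; rewrite /upd /= s1.
suff clear k u s' : n < u -> conf n W u = (lbl.+3, s') -> s' 0 = n -> s' 1 = m.+1 ->
    s' 2 = k -> exists2 u', u <= u' & at_round m.+1 0 u'.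
  have [u' le_u hu] := clear y t'.+2 _ ltac:(lia) c2 s0 erefl s2.
  by exists t'.+1, u'; split=> //; [lia|rewrite c1].
elim: k u s' => [|k IHk] u s' nu cu s'0 s'1 s'2.
  exists u.+1 => //; split; first lia.
  rewrite conf_step // cu stepE.
  have := program_tail 3; rewrite addn3 => -> /=; rewrite s'2 /=.
  by exists (upd s' 2 0); rewrite /upd /= s'0 s'1.
have [|||||u' le_u hu] := IHk u.+1 (upd s' 2 k) => //; first lia.
  rewrite conf_step // cu stepE.
  by have := program_tail 3; rewrite addn3 => -> /=; rewrite s'2 /=.
by exists u' => //; lia.
Qed.

Lemma at_round_next m t : at_round m 0 t -> (exists y, Q m y) -> exists t1 t',
  [/\ t <= t1 < t', (conf n W t1).1 = lbl.+2 & at_round m.+1 0 t'].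
Proof.
move=> ht [y0 hy0].
have ex : exists y, `[< Q m y >] by exists y0; apply/asboolP.
(* The values of [y] are tried in increasing order, so the round succeeds at the least one. *)
case: (ex_minnP ex) => y /asboolP hy ymin.
suff [t1 tt1 ht1] : exists2 t1, t <= t1 & at_round m y t1.
  by have [t2 [t' [? ? ?]]] := at_round_ok ht1 hy; exists t2, t'; split=> //; lia.
have : forall y', y' < y -> ~ Q m y'.
  by move=> y' lt_y /asboolP/ymin; lia.
elim: y {hy ymin} => [|y IHy] h; first by exists t.
have [t1 tt1 ht1] := IHy (fun y' hy' => h y' (ltnW hy')).
by have [t2 tt2 [ht2 _]] := at_round_fail ht1 (h y (ltnSn y)); exists t2 => //; lia.
Qed.

Lemma recurrentP :
  (forall N, exists2 j, N <= j & (conf n W j).1 = lbl.+2) <-> forall m, exists y, Q m y.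
Proof.
split=> [rec|hQ N].
  suff h : forall m, exists t, at_round m 0 t /\ exists y, Q m y.
    by move=> m; have [t []] := h m.
  (* Without a witness for [m], failing attempts follow each other forever and [lbl.+2] is avoided
     from [t] on. *)
  have key m t : at_round m 0 t -> exists y, Q m y.
    move=> ht; apply: contrapT => no.
    have {}no y : ~ Q m y by move=> hy; apply: no; exists y.
    have h y : exists2 t', t + y <= t' & at_round m y t' /\
        forall i, t <= i < t' -> (conf n W i).1 != lbl.+2.
      elim: y => [|y [t1 tt1 [ht1 no1]]]; first by exists t; [lia|split=> // i; lia].
      have [t2 tt2 [ht2 no2]] := at_round_fail ht1 (no y).
      exists t2; first lia.
      split=> // i /andP[ti it]; case: (ltnP i t1) => h; first by apply: no1; rewrite ti.
      by apply: no2; rewrite h.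
    have [j tj cj] := rec t; have [t' tt' [_ /(_ j)]] := h j.+1.
    by rewrite cj eqxx => hh; suff : false by []; apply: hh; lia.
  elim=> [|m [t [ht hy]]].
    by exists n.+2; split; [exact: at_round0|exact: key at_round0].
  have [t1 [t' [_ _ ht']]] := at_round_next ht hy.
  by exists t'; split=> //; exact: key ht'.
have h m : exists2 t, m <= t & at_round m 0 t.
  elim: m => [|m [t mt ht]]; first by exists n.+2 => //; exact: at_round0.
  by have [t1 [t' [? _ ?]]] := at_round_next ht (hQ m); exists t' => //; lia.
have [t Nt ht] := h N.
by have [t1 [t' [? ? _]]] := at_round_next ht (hQ N); exists t1 => //; lia.
Qed.

End Machine.

(** * Runs of timed automata and unit gaps *)

Section Runs.
Variable R : realType.
Local Open Scope ring_scope.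

Definition after k (w : timed_word R k) (i : nat) : R :=
  \sum_(j < i) (w j).1%:num.

Lemma after0 k (w : timed_word R k) : after w 0 = 0.
Proof. by rewrite /after big_ord0. Qed.

Lemma afterS k (w : timed_word R k) i : after w i.+1 = after w i + (w i).1%:num.
Proof. by rewrite /after big_ord_recr. Qed.

Lemma after_lt k (w : timed_word R k) : {mono after w : i j / (i < j)%N >-> i < j}.
Proof.
apply: leW_mono; apply: le_mono => i j.
elim: j => // j IHj; rewrite ltEnat /= ltnS leq_eqVlt afterS => /orP[/eqP->|/IHj].
  by rewrite ltrDl.
by move=> /lt_le_trans; apply; rewrite lerDl.
Qed.

Lemma after_le k (w : timed_word R k) : {mono after w : i j / (i <= j)%N >-> i <= j}.
Proof. by move=> i j; rewrite leNgt after_lt -leqNgt. Qed.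

Lemma after_inj k (w : timed_word R k) : injective (after w).
Proof. by move=> i j e; apply/eqP; rewrite eqn_leq -!(after_le w) e lexx. Qed.

Lemma after_ge0 k (w : timed_word R k) i : 0 <= after w i.
Proof. by rewrite -(after0 w) after_le. Qed.

Section Transitions.
Variables k n m : nat.
Implicit Types e f : nat -> transition k n m.

Fixpoint last_reset e (i : nat) (x : 'I_m) : option nat :=
  if i is j.+1 then if x \in resets (e j) then Some j else last_reset e j x
  else None.

Lemma last_reset_lt e i x j : last_reset e i x = Some j -> (j < i)%N.
Proof. by elim: i => //= i IHi; case: ifP => [_ [<-]|_ /IHi/ltnW]. Qed.

Lemma last_reset_le e i i' x j : (i <= i')%N -> last_reset e i' x = Some j ->
  (j < i)%N -> last_reset e i x = Some j.
Proof.
move=> /subnKC <-; elim: (i' - i)%N => [|d IHd]; first by rewrite addn0.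
by rewrite addnS /=; case: ifP => // _ [<-]; lia.
Qed.

Lemma eq_last_reset e f i x : (forall j, (j < i)%N -> e j = f j) ->
  last_reset e i x = last_reset f i x.
Proof.
elim: i => //= i IHi h; rewrite h // IHi // => j ji.
by apply: h; lia.
Qed.

(* Value of the clock [x] at the event [i], before the resets. *)
Definition clock (w : timed_word R k) e i x : R :=
  after w i.+1 - oapp (fun j => after w j.+1) 0 (last_reset e i x).

Lemma clock_ge0 w e i x : 0 <= clock w e i x.
Proof.
rewrite /clock; case E: last_reset => [j|] /=; last by rewrite subr0 after_ge0.
by rewrite subr_ge0 after_le; have := last_reset_lt E; lia.
Qed.

End Transitions.

Definition run_step k (A : tba k) (w : timed_word R k)
    (e : nat -> transition k (nstates A) (nclocks A)) (i : nat) : Prop :=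
  [/\ e i \in transitions A, target (e i) = source (e i.+1),
      label (e i) = (w i).2 & guard_sat (clock w e i) (cond (e i))].

Lemma eq_guard_sat m (v v' : 'I_m -> R) g : v =1 v' -> guard_sat v g = guard_sat v' g.
Proof. by move=> /funext ->. Qed.

(** States and valuations are functions of the transitions taken. A run becomes a bare sequence [e],
    which can be replayed on another word with unchanged acceptance. *)
Lemma langE k (A : tba k) (w : timed_word R k) : lang A w <->
  exists e, [/\ source (e 0%N) \in initial A, forall i, run_step w e i &
    forall N : nat, exists2 i : nat, (N <= i)%N & source (e i) \in accepting A].
Proof.
split=> [[q [v [e [[q0 v0 he] acc]]]]|[e [e0 he acc]]].
  exists e.
  have sq i : source (e i) = q i by have [_ []] := he i.
  have vE i x : v i x = after w i - oapp (fun j => after w j.+1) 0 (last_reset e i x).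
    elim: i => [|i IHi] /=; first by rewrite v0 after0 subr0.
    have [_ _ _ _ ->] := he i; case: ifP => _ /=; first by rewrite subrr.
    by rewrite IHi afterS addrAC.
  split=> [|i|N]; first by rewrite sq.
    have [h1 [h2 h2'] h3 h4 _] := he i; split=> //; first by rewrite sq.
    rewrite -(eq_guard_sat _ (v := fun x => v i x + (w i).1%:num)) // => x.
    by rewrite /clock vE afterS addrAC.
  by have [i Ni ai] := acc N; exists i => //; rewrite sq.
exists (fun i => source (e i)).
exists (fun i x => after w i - oapp (fun j => after w j.+1) 0 (last_reset e i x)), e.
split=> //; split=> // [x|i]; first by rewrite /= after0 subr0.
have [h1 h2 h3 h4] := he i; split=> //.
  rewrite -(eq_guard_sat _ (v := clock w e i)) // => x.
  by rewrite /clock afterS addrAC.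
by move=> x /=; case: ifP => _ /=; rewrite ?subrr // afterS addrAC.
Qed.

(** By induction, since the source and the clocks at the event [i] depend only on the word and on
    the transitions taken before. *)
Lemma deterministic_run k (D : tba k) (w : timed_word R k) e f L :
  deterministic R D -> source (e 0%N) \in initial D -> source (f 0%N) \in initial D ->
  (forall i, (i < L)%N -> run_step w e i) -> (forall i, (i < L)%N -> run_step w f i) ->
  forall i, (i < L)%N -> e i = f i.
Proof.
move=> [init1 det] e0 f0 he hf i; elim/ltn_ind: i => i IHi iL.
have IH j : (j < i)%N -> e j = f j by move=> ji; apply: IHi => //; lia.
have [e1 e2 e3 e4] := he i iL; have [f1 f2 f3 f4] := hf i iL.
apply: contrapT => ef; apply: (det _ _ e1 f1 ef _ _ (clock w e i)).
- case: i IH {IHi iL e1 e2 e3 e4 f1 f2 f3 f4 ef} (iL) => [|i] IH iL.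
    by move/eqP/cards1P: init1 => [x ix]; move: e0 f0; rewrite ix !inE => /eqP-> /eqP->.
  have [_ <- _ _] := he i ltac:(lia); have [_ <- _ _] := hf i ltac:(lia).
  by rewrite IH.
- by rewrite e3 f3.
- by move=> x; exact: clock_ge0.
split=> //; rewrite (eq_guard_sat (v' := clock w f i)) // => x.
by rewrite /clock (eq_last_reset _ IH).
Qed.

(** Coarser than the regions of Alur and Dill: diagonal-free guards only compare single clocks with
    integers. *)
Definition same_region (a b : R) :=
  forall c : nat, (a < c%:R) = (b < c%:R) /\ (a == c%:R) = (b == c%:R).

Lemma guard_sat_region m (v v' : 'I_m -> R) g :
  (forall x, same_region (v x) (v' x)) -> guard_sat v g = guard_sat v' g.
Proof.
move=> h; elim: g => //= [x r c|g ->|g -> g' ->|g -> g' ->] //.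
have [lt eq] := h x c.
case: r => /=.
- exact: lt.
- by rewrite !le_eqVlt lt eq.
- exact: eq.
- by rewrite !leNgt lt.
- by rewrite !ltNge !le_eqVlt lt eq.
Qed.

Lemma same_region_refl (a : R) : same_region a a.
Proof. by []. Qed.

Lemma same_region_unit (a b : R) c : c%:R < a < c.+1%:R -> c%:R < b < c.+1%:R ->
  same_region a b.
Proof.
have aux (x : R) d : c%:R < x < c.+1%:R ->
    (x < d%:R) = (c < d)%N /\ (x == d%:R) = false.
  move=> /andP[cx xc]; case: (ltnP c d) => h.
    have : x < d%:R by apply: lt_le_trans xc _; rewrite ler_nat.
    by move=> xd; rewrite xd lt_eqF.
  have : d%:R < x by apply: le_lt_trans cx; rewrite ler_nat.
  by move=> dx; rewrite gt_eqF // ltNge ltW.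
by move=> ha hb d; have [-> ->] := aux a d ha; have [-> ->] := aux b d hb.
Qed.

End Runs.

(** * Shifting one event of a block unnoticed *)

Section UnitGap.
Variables (R : realType) (k : nat) (a : 'I_k) (u : timed_word R k).
Variable S : set (timed_word R k).
Local Open Scope ring_scope.

Hypothesis unit_gap : forall (w : timed_word R k) (L : nat),
  (forall p, (p < L)%N -> (w p).2 = a) -> (forall p, w (L + p)%N = u p) ->
  S w <-> exists p q, (p < q < L)%N /\ after w q.+1 = after w p.+1 + 1.

(* The event [p < L] has letter [a] and occurs at time [f p / M.+1]. *)
Definition grid_word (f : nat -> nat) (M L : nat) : timed_word R k := fun p =>
  if (p < L)%N then
    (((f p - (if p is q.+1 then f q else 0))%N.-1.+1%:R / M.+1%:R)%:pos, a)
  else u (p - L)%N.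

(** Monotonicity undoes the [.-1.+1] by which [grid_word] makes every delay positive. *)
Lemma after_grid f M L p : (0 < f 0)%N ->
  (forall q, (q.+1 < L)%N -> (f q < f q.+1)%N) -> (p < L)%N ->
  after (grid_word f M L) p.+1 = (f p)%:R / M.+1%:R.
Proof.
move=> f0 fS; elim: p => [|p IHp] pL; rewrite afterS /grid_word pL -/(grid_word _ _ _) /=.
  by rewrite after0 add0r subn0 prednK.
have lt_f := fS p pL; rewrite IHp; last lia.
rewrite prednK ?subn_gt0 // -mulrDl -natrD; congr (_%:R / _); lia.
Qed.

Lemma after_grid_tail f f' M L p :
  (0 < f 0)%N -> (0 < f' 0)%N -> (0 < L)%N ->
  (forall q, (q.+1 < L)%N -> (f q < f q.+1)%N) ->
  (forall q, (q.+1 < L)%N -> (f' q < f' q.+1)%N) ->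
  f L.-1 = f' L.-1 -> (L <= p)%N ->
  after (grid_word f M L) p.+1 = after (grid_word f' M L) p.+1.
Proof.
move=> f0 f'0 L0 fS f'S eL Lp; have -> : p.+1 = (L.-1.+1 + (p - L).+1)%N by lia.
elim: (p - L).+1 => [|d IHd].
  by rewrite addn0 !after_grid ?eL //; lia.
rewrite addnS; move: (L.-1.+1 + d)%N (leq_addr d L.-1.+1) IHd => t Lt IHd.
rewrite !afterS IHd; congr (_ + _).
by rewrite /grid_word !ifN //; lia.
Qed.

Section Words.
Variable N : nat.

(** With [M.+1 = N + N + 3], the formula for odd positions in [gapless] puts the last event, of
    index [N + N], exactly at time 2. *)
Let M := (N + N + 2)%N.
Let L := (N + N).+1.

(* Numerators over [M.+1]: [N] events at even positions of the first time unit,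
   [N] events at odd positions of the second one, and a last event at time 2
   which absorbs the shift, made in [gapped i], of the event [N + i] to exactly
   one time unit after the event [i]. *)
Definition gapless (p : nat) : nat :=
  if (p < N)%N then (p + p + 2)%N else (M.+1 + ((p - N) + (p - N) + 3))%N.

Definition gapped (i p : nat) : nat :=
  if p == (N + i)%N then (M.+1 + (i + i + 2))%N else gapless p.

Let w := grid_word gapless M L.
Let w' i := grid_word (gapped i) M L.

Let gaplessS q : (q.+1 < L)%N -> (gapless q < gapless q.+1)%N.
Proof.
by rewrite /gapless /M /L; case: (ltnP q N); case: (ltnP q.+1 N) => ? ? ?; lia.
Qed.

Let gapless0 : (0 < gapless 0)%N.
Proof. by rewrite /gapless; case: (ltnP 0 N) => ?; lia. Qed.

Let gappedS i q : (i < N)%N -> (q.+1 < L)%N -> (gapped i q < gapped i q.+1)%N.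
Proof.
rewrite /gapped /gapless /M /L; case: (ltnP q N); case: (ltnP q.+1 N) => ? ? ? ?;
  case: eqP => ?; case: eqP => ?; lia.
Qed.

Let gapped0 i : (0 < gapped i 0)%N.
Proof. by rewrite /gapped; case: eqP => // _; rewrite addn_gt0. Qed.

Lemma eq_grid_unit (x y : nat) :
  (x%:R / M.+1%:R == y%:R / M.+1%:R + 1 :> R) = (x == (y + M.+1)%N).
Proof.
have M0 : M.+1%:R != 0 :> R by rewrite pnatr_eq0.
by rewrite -(inj_eq (mulIf M0)) mulrDl !divfK // mul1r -natrD eqr_nat.
Qed.

(** Two events of the same half are less than one unit apart. Across the halves parity decides:
    numerators are even in the first, and odd in the second after subtracting [M.+1]. *)
Lemma gapless_notin : ~ S w.
Proof.
rewrite (@unit_gap _ L) => [|p pL|p]; last 2 first.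
- by rewrite /w /grid_word pL.
- by rewrite /w /grid_word ifN ?addKn //; lia.
move=> [p [q [/andP[pq qL]]]]; rewrite !after_grid //; last lia.
move/eqP; rewrite eq_grid_unit.
by rewrite /gapless /M; case: (ltnP q N); case: (ltnP p N) => ? ? /eqP; lia.
Qed.

Lemma gapped_in i : (i < N)%N -> S (w' i).
Proof.
move=> iN; rewrite (@unit_gap _ L) => [|p pL|p]; last 2 first.
- by rewrite /w' /grid_word pL.
- by rewrite /w' /grid_word ifN ?addKn //; lia.
exists i, (N + i)%N; split; first by rewrite /L; lia.
have hS q := @gappedS i q iN.
rewrite !after_grid //; do ?[by rewrite /L; lia].
apply/eqP; rewrite eq_grid_unit.
have -> : gapped i (N + i) = (M.+1 + (i + i + 2))%N by rewrite /gapped eqxx.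
have -> : gapped i i = (i + i + 2)%N by rewrite /gapped ifN /gapless ?iN //; lia.
by apply/eqP; lia.
Qed.

Lemma grid_region (x y x' y' c : nat) :
  (c * M.+1 + y < x < c.+1 * M.+1 + y)%N ->
  (c * M.+1 + y' < x' < c.+1 * M.+1 + y')%N ->
  same_region (x%:R / M.+1%:R - y%:R / M.+1%:R : R) (x'%:R / M.+1%:R - y'%:R / M.+1%:R).
Proof.
have M0 : 0 < M.+1%:R :> R by rewrite ltr0n.
have aux (z t : nat) : (c * M.+1 + t < z < c.+1 * M.+1 + t)%N ->
    c%:R < (z%:R / M.+1%:R - t%:R / M.+1%:R : R) < c.+1%:R.
  move=> /andP[h1 h2]; rewrite -mulrBl; apply/andP; split.
    by rewrite ltr_pdivlMr // ltrBrDr -natrM -natrD ltr_nat.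
  by rewrite ltr_pdivrMr // ltrBlDr -natrM -natrD ltr_nat.
by move=> /aux h /aux h'; exact: same_region_unit h h'.
Qed.

(** Only the event [N + i] moves, by one grid step, so a reading changes only at this event or for a
    clock last reset by it. Such a reading stays within an open unit interval, except for a clock
    reset at [i], which reaches 1, or one still counting from [N + i] after the block: the two
    hypotheses exclude these. *)
Lemma gap_region n m (e : nat -> transition k n m) i p x : (i < N)%N ->
  last_reset e N x <> Some i ->
  ((L <= p)%N -> last_reset e L x <> Some (N + i)%N) ->
  same_region (clock w e p x) (clock (w' i) e p x).
Proof.
move=> iN h1 h2; rewrite /clock.
have hS q := @gappedS i q iN.
have eq_after q : q <> (N + i)%N -> after w q.+1 = after (w' i) q.+1.
  move=> qi; case: (ltnP q L) => qL.
    by rewrite !after_grid // /gapped; case: eqP.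
  apply: (after_grid_tail _ gapless0 (gapped0 i) (ltn0Sn _) gaplessS hS _ qL).
  by rewrite /gapped; case: eqP => //; rewrite /L; lia.
have NiL : (N + i < L)%N by rewrite /L; lia.
have aw : after w (N + i).+1 = (M.+1 + (i + i + 3))%:R / M.+1%:R.
  by rewrite after_grid // /gapless ifN ?addKn //; lia.
have aw' : after (w' i) (N + i).+1 = (M.+1 + (i + i + 2))%:R / M.+1%:R.
  by rewrite after_grid // /gapped eqxx.
case: (eqVneq p (N + i)%N) => [pi|/eqP pi].
  case E: last_reset => [j|]; rewrite pi aw aw' /=; last first.
    have -> : (0 : R) = 0%:R / M.+1%:R by rewrite mul0r.
    by apply: (@grid_region _ _ _ _ 1); rewrite /M; lia.
  have jp := last_reset_lt E; rewrite pi in jp.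
  rewrite -eq_after; last lia.
  rewrite after_grid //; last lia.
  rewrite /gapless; case: ltnP => jN.
    have ji : j <> i.
      by move=> ji; apply: h1; rewrite -ji; apply: last_reset_le E _ => //; lia.
    by case: (ltnP j i) => ji'; [apply: (@grid_region _ _ _ _ 1)|apply: (@grid_region _ _ _ _ 0)];
      rewrite /M; lia.
  by apply: (@grid_region _ _ _ _ 0); rewrite /M; lia.
rewrite -eq_after //; case E: last_reset => [j|] /=; last exact: same_region_refl.
case: (eqVneq j (N + i)%N) => [ji|/eqP ji]; last by rewrite -eq_after.
have jp := last_reset_lt E; rewrite ji aw aw'.
case: (ltnP p L) => pL; last first.
  by case: (h2 pL); rewrite -ji; apply: last_reset_le E _ => //; lia.
rewrite after_grid // /gapless ifN; last lia.
by apply: (@grid_region _ _ _ _ 0); move: pL; rewrite /M /L; lia.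
Qed.

Lemma gap_run_step (A : tba k) e i p : (i < N)%N ->
  (forall x, last_reset e N x <> Some i) ->
  ((L <= p)%N -> forall x, last_reset e L x <> Some (N + i)%N) ->
  @run_step R k A w e p <-> @run_step R k A (w' i) e p.
Proof.
move=> iN h1 h2.
have el : (w p).2 = (w' i p).2 by rewrite /w /w' /grid_word; case: ifP.
rewrite /run_step el (@guard_sat_region _ _ (clock w e p) (clock (w' i) e p)) // => x.
by apply: gap_region => // pL; exact: h2.
Qed.

End Words.

(** Pigeonhole: each of the [m] clocks excludes at most one index through [f] and one through
    [g]. *)
Lemma avoid_pair m (f g : 'I_m -> option nat) : exists2 i, (i < m + m + 1)%N &
  forall x, f x <> Some i /\ g x <> Some ((m + m + 1) + i)%N.
Proof.
set N := (m + m + 1)%N.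
pose s := [seq odflt N (f x) | x <- enum 'I_m] ++ [seq (odflt N (g x) - N)%N | x <- enum 'I_m].
have szs : (size s < N)%N by rewrite /s size_cat 2!size_map size_enum_ord /N; lia.
case: (boolP (all (mem s) (iota 0 N))) => [/allP h|/allPn[i]].
  by have := @uniq_leq_size _ (iota 0 N) s (iota_uniq 0 N) h; rewrite size_iota leqNgt szs.
rewrite mem_iota /= add0n => iN; rewrite mem_cat negb_or => /andP[i1 i2].
exists i => // x; split=> fx.
  by move/negP: i1; apply; apply/mapP; exists x; rewrite ?mem_enum ?fx.
by move/negP: i2; apply; apply/mapP; exists x; rewrite ?mem_enum ?fx //= addKn.
Qed.

(** An accepting run on the word without gap can be replayed on a word of [S]. *)
Lemma unit_gap_not_lang_compl (B : tba k) : lang B <> ~` S.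
Proof.
move=> eB; set m := nclocks B.
have : lang B (grid_word (gapless (m + m + 1)) ((m + m + 1) + (m + m + 1) + 2)
    ((m + m + 1) + (m + m + 1)).+1) by rewrite eB; exact: gapless_notin.
move=> /langE[e [e0 he acc]].
have [i iN hi] := avoid_pair (last_reset e (m + m + 1))
  (last_reset e ((m + m + 1) + (m + m + 1)).+1).
have : lang B (grid_word (gapped (m + m + 1) i) ((m + m + 1) + (m + m + 1) + 2)
    ((m + m + 1) + (m + m + 1)).+1).
  apply/langE; exists e; split=> // p; apply/gap_run_step => // [x|_ x];
    by have [] := hi x.
by rewrite eB; apply; exact: gapped_in.
Qed.

(* The runs on the words with a unit gap at [i] agree, on the first half by
   determinism and, for those [i] which are not remembered by a clock, on the
   second half because they also are runs on the word without unit gaps. *)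
Lemma unit_gap_not_deterministic (D : tba k) : deterministic R D -> lang D <> S.
Proof.
move=> detD eD; set m := nclocks D; set N := (m + m + 1)%N; set L := (N + N).+1.
have ex i : exists e, (i < N)%N -> [/\ source (e 0%N) \in initial D,
    forall p, @run_step R k D (grid_word (gapped N i) (N + N + 2) L) e p &
    forall N' : nat, exists2 j : nat, (N' <= j)%N & source (e j) \in accepting D].
  have [iN|Ni] := ltnP i N.
    have := @gapped_in N i iN; rewrite -eD => /langE[e he]; by exists e.
  have := @gapped_in N 0 ltac:(by rewrite /N; lia); rewrite -eD => /langE[e _].
  by exists e.
have [e he] := choice ex.
pose w := grid_word (gapless N) (N + N + 2) L.
(* The moved event has index at least [N]: before it, all these words coincide. *)
have half i : (i < N)%N -> forall p, (p < N)%N -> run_step w (e i) p.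
  move=> iN p pN; have [_ /(_ p) [h1 h2 h3 h4] _] := he i iN; split=> //.
    by rewrite h3 /w /grid_word; case: ifP.
  rewrite (eq_guard_sat (v' := clock (grid_word (gapped N i) (N + N + 2) L) (e i) p)) // => x.
  have eqa q : (q <= N)%N -> after w q = after (grid_word (gapped N i) (N + N + 2) L) q.
    elim: q => [|q IHq] qN; first by rewrite !after0.
    rewrite !afterS IHq; last lia.
    congr (_ + _); rewrite /w /grid_word ifT; last by rewrite /L; lia.
    rewrite ifT; last by rewrite /L; lia.
    congr (_%:num); congr (_.1); congr pair.
    by rewrite /gapped ifN; [case: q {IHq} qN => // q qN; rewrite ifN //; lia|lia].
  rewrite /clock eqa //; case E: last_reset => [j|] //=; rewrite eqa //.
  by have := last_reset_lt E; lia.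
have N0 : (0 < N)%N by rewrite /N; lia.
have half_eq i j : (i < N)%N -> (j < N)%N -> forall p, (p < N)%N -> e i p = e j p.
  move=> iN jN; have [i0 _ _] := he i iN; have [j0 _ _] := he j jN.
  by apply: (deterministic_run detD i0 j0); [exact: half|exact: half].
have forgets i : (i < N)%N -> (forall x, last_reset (e 0%N) N x <> Some i) ->
    forall x, last_reset (e i) N x <> Some i.
  by move=> iN h x; rewrite (eq_last_reset x (half_eq i 0%N iN N0)).
have full i : (i < N)%N -> (forall x, last_reset (e 0%N) N x <> Some i) ->
    forall p, (p < L)%N -> run_step w (e i) p.
  move=> iN hi p pL; have [_ /(_ p) hp _] := he i iN.
  apply/(@gap_run_step N D (e i) i p iN (forgets i iN hi)); last exact: hp.
  by move=> Lp; exfalso; move: Lp pL; rewrite /L; lia.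
(* The index [i] must avoid the resets of its own run [e i]. The reference run [e i0] breaks this
   circularity: up to [L] it agrees with [e i] for every [i] forgotten at [N]. *)
have [i0 i0N hi0] := avoid_pair (last_reset (e 0%N) N) (fun=> None).
have [i iN hi] := avoid_pair (last_reset (e 0%N) N) (last_reset (e i0) L).
have fi0 x : last_reset (e 0%N) N x <> Some i0 by have [] := hi0 x.
have fi x : last_reset (e 0%N) N x <> Some i by have [] := hi x.
have full_eq p : (p < L)%N -> e i p = e i0 p.
  have [i1 _ _] := he i iN; have [i2 _ _] := he i0 i0N.
  by apply: (deterministic_run detD i1 i2); apply: full.
have [h0 hrun hacc] := he i iN.
apply: (@gapless_notin N); rewrite -eD; apply/langE; exists (e i); split=> // p.
apply/(@gap_run_step N D (e i) i p iN (forgets i iN fi)); last exact: hrun.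
by move=> _ x; rewrite (eq_last_reset x full_eq); have [] := hi x.
Qed.

End UnitGap.

(** * Detection of ill-formed words *)

(** [Main] has guessed nothing yet and [Acc] is the sink of proved violations. [Nxt] remembers the
    previous letter, [Cpy c] awaits the copy of [c], [Btw] a cell inserted between two copies, [Awt]
    a second letter [None] at distance 1, [Ini] a wrong end of the initial phase; [Fin] bets on no
    further [sig]. *)
Inductive dstate (C : Type) :=
| Main | Acc | Btw | Awt | Ini | Fin | Nxt of option C | Cpy of C.
Arguments Main {C}.
Arguments Acc {C}.
Arguments Btw {C}.
Arguments Awt {C}.
Arguments Ini {C}.
Arguments Fin {C}.

Section DState.
Variable C : Type.

Definition dstate_enc (q : dstate C) : 'I_6 + (option C + C) :=
  match q with
  | Main => inl (inord 0) | Acc => inl (inord 1) | Btw => inl (inord 2)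
  | Awt => inl (inord 3) | Ini => inl (inord 4) | Fin => inl (inord 5)
  | Nxt l => inr (inl l) | Cpy c => inr (inr c)
  end.

Definition dstate_dec (z : 'I_6 + (option C + C)) : dstate C :=
  match z with
  | inl i => nth Main [:: Main; Acc; Btw; Awt; Ini; Fin] i
  | inr (inl l) => Nxt l
  | inr (inr c) => Cpy c
  end.

Lemma dstate_encK : cancel dstate_enc dstate_dec.
Proof. by case=> //=; rewrite inordK. Qed.

End DState.

HB.instance Definition _ (C : finType) :=
  Finite.copy (dstate C) (can_type (@dstate_encK C)).

(** Symbolic guards keep the list of moves independent of [n], which [gkind_guard] inserts
    afterwards. *)
Variant gkind := KTrue | KBetween | KNeq1 | KEq1 | KNeqN | KEqN.

Definition gkind_code (g : gkind) : nat :=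
  match g with
  | KTrue => 0 | KBetween => 1 | KNeq1 => 2 | KEq1 => 3 | KNeqN => 4 | KEqN => 5
  end.

Lemma gkind_code_inj : injective gkind_code.
Proof. by case; case. Qed.

HB.instance Definition _ := Equality.copy gkind (inj_type gkind_code_inj).

Definition clk_x : 'I_2 := ord0.
Definition clk_y : 'I_2 := ord_max.

Definition no_reset : {set 'I_2} := finset.set0.
Definition reset_x : {set 'I_2} := [set clk_x]%SET.
Definition reset_y : {set 'I_2} := [set clk_y]%SET.

Definition gkind_guard (n : nat) (g : gkind) : guard 2 :=
  match g with
  | KTrue => GTrue
  | KBetween => GAnd (GCmp clk_x CGt 1) (GCmp clk_y CLt 1)
  | KNeq1 => GNot (GCmp clk_x CEq 1)
  | KEq1 => GCmp clk_x CEq 1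
  | KNeqN => GNot (GCmp clk_x CEq n.+1)
  | KEqN => GCmp clk_x CEq n.+1
  end.

Definition gkind_sat (R : realType) (n : nat) (g : gkind) (x y : R) : bool :=
  (match g with
  | KTrue => true
  | KBetween => (1 < x) && (y < 1)
  | KNeq1 => x != 1
  | KEq1 => x == 1
  | KNeqN => x != n.+1%:R
  | KEqN => x == n.+1%:R
  end)%R.

Lemma gkind_guardP (R : realType) n g (v : 'I_2 -> R) :
  guard_sat v (gkind_guard n g) = gkind_sat n g (v clk_x) (v clk_y).
Proof. by case: g. Qed.

Lemma mem_opt (T : eqType) (b : bool) (y z : T) :
  (z \in [seq y | _ <- nseq b tt]) = b && (z == y).
Proof. by case: b; rewrite //= inE. Qed.

Section Detector.
Variable C : finType.
Variables (next copy : rel C) (new init mark anti sig : pred C).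

Definition follows (l l' : option C) : bool :=
  match l, l' with
  | None, None => true
  | None, Some c => init c
  | Some _, None => false
  | Some c, Some d => next c d
  end.

Definition on (P : pred C) (l : option C) : bool := oapp P false l.

(* A well-formed word: letters [None], no two of them at distance 1, followed
   by cells such that each of them has a copy exactly one time unit later, all
   the cells between the copies of two consecutive ones being new. *)
Record good (R : realType) (n : nat) (T : nat -> R) (l : nat -> option C) : Prop := Good {
  good_first : follows None (l 0);
  good_next : forall p, follows (l p) (l p.+1);
  good_copy : forall p c, l p = Some c ->
    exists q, [/\ (p < q)%N, T q = T p + 1 & on (copy c) (l q)]%R;
  good_between : forall p q, p.+1 < q -> l p != None ->
    (T p + 1 < T q -> T q < T p.+1 + 1 -> on new (l q))%R;
  good_gap : forall p q, p < q -> l p = None -> l q = None -> (T q <> T p + 1)%R;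
  good_mark : forall p q, p < q -> on init (l p) -> on mark (l q) ->
    (T q = T p + n.+1%:R)%R;
  good_anti : forall p q, p < q -> on init (l p) -> on anti (l q) ->
    (T q <> T p + n.+1%:R)%R;
  good_init : forall p, on init (l p) -> (T p.+1 = T p + 1)%R;
  good_sig : forall N, exists2 p, N <= p & on sig (l p) }.

Record good_cells (R : realType) (n : nat) (T : nat -> R) (c : nat -> C) : Prop := GoodCells {
  cells_first : init (c 0);
  cells_next : forall p, next (c p) (c p.+1);
  cells_copy : forall p, exists q, [/\ (p < q)%N, T q = T p + 1 & copy (c p) (c q)]%R;
  cells_between : forall p q, p.+1 < q ->
    (T p + 1 < T q -> T q < T p.+1 + 1 -> new (c q))%R;
  cells_mark : forall p q, p < q -> init (c p) -> mark (c q) -> (T q = T p + n.+1%:R)%R;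
  cells_anti : forall p q, p < q -> init (c p) -> anti (c q) -> (T q <> T p + n.+1%:R)%R;
  cells_init : forall p, init (c p) -> (T p.+1 = T p + 1)%R;
  cells_sig : forall N, exists2 p, N <= p & sig (c p) }.

(** Recurrence of [sig] provides a first cell; [follows] makes it an [init] one and forbids [None]
    after it. *)
Lemma good_cells_of_good (R : realType) n (T : nat -> R) l :
  good n T l -> exists p0 c, good_cells n (fun p => T (p0 + p)) c.
Proof.
move=> G.
have ex : exists p, l p != None.
  by have [p _] := good_sig G 0; case E: (l p) => // _; exists p; rewrite E.
case: (ex_minnP ex) => p0 lp0 minp0.
have lS p : l (p0 + p) != None.
  elim: p => [|p IHp]; first by rewrite addn0.
  rewrite addnS; have := good_next G (p0 + p).
  by case: (l (p0 + p)) IHp => // c _; case: (l _).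
have exc p : exists c, l (p0 + p) = Some c.
  by have := lS p; case: (l _) => // c _; exists c.
have [c hc] := choice exc.
have on_c P p : on P (l (p0 + p)) = P (c p) by rewrite hc.
exists p0, c; split.
- rewrite -on_c addn0; case: p0 lp0 minp0 {lS hc on_c exc} => [|p0] lp0 minp0.
    by have := good_first G; case: (l 0) lp0.
  have : l p0 == None by apply: contraT => /minp0; rewrite ltnn.
  by have := good_next G p0; case: (l p0) => // ; case: (l p0.+1) lp0.
- by move=> p; have := good_next G (p0 + p); rewrite -addnS !hc.
- move=> p; have [q [pq Tq cq]] := good_copy G (hc p).
  exists (q - p0); rewrite subnKC; last lia.
  split=> //; first lia.
  by rewrite -on_c subnKC //; lia.
- move=> p q pq h1 h2; rewrite -on_c; apply: (good_between G) (lS p) h1 _; first lia.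
  by rewrite -addnS.
- move=> p q pq ip mq; apply: (good_mark G); rewrite ?on_c //; lia.
- move=> p q pq ip mq; apply: (good_anti G); rewrite ?on_c //; lia.
- by move=> p ip; rewrite addnS; apply: (good_init G); rewrite on_c.
- move=> N; have [p Np sp] := good_sig G (p0 + N).
  by exists (p - p0); [lia|rewrite -on_c subnKC //; lia].
Qed.

Lemma good_of_good_cells (R : realType) n (T : nat -> R) l c L :
  good_cells n (fun p => T (L + p)) c ->
  (forall p, p < L -> l p = None) -> (forall p, l (L + p) = Some (c p)) ->
  (forall p q, p < q < L -> (T q <> T p + 1)%R) -> good n T l.
Proof.
move=> G lN lS gap.
have on_lt P p : p < L -> on P (l p) = false by move=> /lN ->.
have on_c P p : on P (l (L + p)) = P (c p) by rewrite lS.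
have split_p p : (p < L) + {q | p = L + q}.
  by case: (ltnP p L) => [|h]; [left|right; exists (p - L); rewrite subnKC].
split.
- case: (split_p 0) => [/lN-> //|[q h]].
  by have := cells_first G; rewrite -on_c addn0 (_ : L = 0); [case: (l 0)|lia].
- move=> p; case: (split_p p) => [pL|[q ->]]; last first.
    by rewrite -addnS !lS; exact: cells_next G _.
  rewrite lN //; case: (split_p p.+1) => [/lN-> //|[q e]].
  have -> : p.+1 = L + 0 by lia.
  by rewrite lS; exact: cells_first G.
- move=> p d; case: (split_p p) => [/lN-> //|[q ->]]; rewrite lS => -[<-].
  have [r [qr Tr cr]] := cells_copy G q.
  by exists (L + r); rewrite on_c; split=> //; lia.
- move=> p q pq; case: (split_p p) => [/lN-> //|[p' e]] _; subst p.
  case: (split_p q) => [?|[q' e]]; first by lia.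
  by subst q; rewrite -addnS on_c => h1 h2; apply: (cells_between G) h1 h2; lia.
- move=> p q pq lp lq; case: (split_p q) => [qL|[q' e]]; last by rewrite e lS in lq.
  by apply: gap; rewrite pq.
- move=> p q pq; case: (split_p p) => [/on_lt-> //|[p' e]]; subst p.
  case: (split_p q) => [?|[q' e]]; first by lia.
  by subst q; rewrite !on_c; apply: (cells_mark G); lia.
- move=> p q pq; case: (split_p p) => [/on_lt-> //|[p' e]]; subst p.
  case: (split_p q) => [?|[q' e]]; first by lia.
  by subst q; rewrite !on_c; apply: (cells_anti G); lia.
- move=> p; case: (split_p p) => [/on_lt-> //|[p' e]]; subst p.
  by rewrite on_c -addnS; exact: cells_init G _.
- move=> N; have [p Np sp] := cells_sig G N.
  by exists (L + p); [lia|rewrite on_c].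
Qed.

Definition dmove := (dstate C * gkind * {set 'I_2})%type.

(* Each way of violating [good] is guessed from [Main]. *)
Definition moves (q : dstate C) (l : option C) : seq dmove :=
  match q with
  | Main => [:: (Main, KTrue, no_reset); (Fin, KTrue, reset_x);
                (Nxt l, KTrue, reset_x)]
            ++ (if l is Some c then [:: (Cpy c, KTrue, reset_x)]
                else [:: (Awt, KTrue, reset_x)])
            ++ [seq (Ini, KTrue, reset_x) | _ <- nseq (on init l) tt]
  | Acc => [:: (Acc, KTrue, no_reset)]
  | Btw => (Btw, KTrue, no_reset) :: [seq (Acc, KBetween, no_reset) | _ <- nseq (~~ on new l) tt]
  | Awt => (Awt, KTrue, no_reset) :: [seq (Acc, KEq1, no_reset) | _ <- nseq (l == None) tt]
  | Ini => (Ini, KTrue, no_reset)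
           :: [seq (Acc, KNeqN, no_reset) | _ <- nseq (on mark l) tt]
           ++ [seq (Acc, KEqN, no_reset) | _ <- nseq (on anti l) tt]
  | Fin => [seq (Fin, KTrue, no_reset) | _ <- nseq (~~ on sig l) tt]
  | Nxt l0 => [seq (Acc, KTrue, no_reset) | _ <- nseq (~~ follows l0 l) tt]
              ++ [seq (Btw, KTrue, reset_y) | _ <- nseq (l0 != None) tt]
              ++ [seq (Acc, KNeq1, no_reset) | _ <- nseq (on init l0) tt]
  | Cpy c => (Cpy c, KNeq1, no_reset)
             :: [seq (Acc, KEq1, no_reset) | _ <- nseq (~~ on (copy c) l) tt]
  end.

(** Starting in [Nxt None] tests the first letter as if [None] had just been read. *)
Definition dinitial (q : dstate C) := (q == Main) || (q == Nxt None).

(** An endless stay in [Cpy c] means that no event occurs at distance exactly 1; a copy with wrong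
    content leads to [Acc]. *)
Definition daccepting (q : dstate C) :=
  match q with Acc | Fin | Cpy _ => true | _ => false end.

Definition nletters := #|{: option C}|.

Definition edge (n : nat) (d : dstate C * option C * dmove) :
    transition nletters #|{: dstate C}| 2 :=
  let: (q, l, (q', g, r)) := d in
  Transition (enum_rank q) (enum_rank l) (gkind_guard n g) r (enum_rank q').

Lemma source_edge n d : source (edge n d) = enum_rank d.1.1.
Proof. by case: d => [[q l] [[q' g] r]]. Qed.

Lemma target_edge n d : target (edge n d) = enum_rank d.2.1.1.
Proof. by case: d => [[q l] [[q' g] r]]. Qed.

Lemma label_edge n d : label (edge n d) = enum_rank d.1.2.
Proof. by case: d => [[q l] [[q' g] r]]. Qed.

Lemma cond_edge n d : cond (edge n d) = gkind_guard n d.2.1.2.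
Proof. by case: d => [[q l] [[q' g] r]]. Qed.

Lemma resets_edge n d : resets (edge n d) = d.2.2.
Proof. by case: d => [[q l] [[q' g] r]]. Qed.

Definition dmoves : seq (dstate C * option C * dmove) :=
  [seq (d, o) | d <- enum {: dstate C * option C}, o <- moves d.1 d.2].

Definition detector (n : nat) : tba nletters :=
  @TBA nletters #|{: dstate C}| 2
    [set i | dinitial (enum_val i)]%SET [set i | daccepting (enum_val i)]%SET
    [seq edge n d | d <- dmoves].

Lemma computable_detector :
  computable (fun n => tba_code (existT _ nletters (detector n))).
Proof.
rewrite /tba_code /=.
apply: computable_cons_code; first exact: computable_const.
apply: computable_cons_code; first exact: computable_const.
apply: computable_cons_code; first exact: computable_const.
apply: computable_cons_code; first exact: computable_const.
apply: computable_cons_code; first exact: computable_const.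
apply: computable_cons_code; last exact: computable_const.
rewrite (_ : (fun n => _) = fun n => CodeSeq.code
    [seq transition_code (edge n d) | d <- dmoves]); last first.
  by apply/funext => n; rewrite -map_comp.
apply: computable_code => -[[q l] [[q' g] r]]; rewrite /transition_code /=.
apply: computable_cons_code; first exact: computable_const.
apply: computable_cons_code; first exact: computable_const.
apply: computable_cons_code; last exact: computable_const.
have cS := computable_succ.
(* Only [KNeqN] and [KEqN] depend on [n]. *)
case: g; do ?exact: computable_const.
  apply: computable_cons_code; first exact: computable_const.
  apply: computable_cons_code; last exact: computable_const.
  do 3!(apply: computable_cons_code; first exact: computable_const).
  by apply: computable_cons_code; last exact: computable_const.
do 3!(apply: computable_cons_code; first exact: computable_const).
by apply: computable_cons_code; last exact: computable_const.
Qed.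

(** * The detector accepts exactly the ill-formed words *)

Section Language.
Variables (R : realType) (n : nat) (w : timed_word R nletters).

Definition evtime (i : nat) : R := after w i.+1.
Definition letter (i : nat) : option C := enum_val (w i).2.

Definition dedge (q : nat -> dstate C) (o : nat -> dmove) i :=
  edge n (q i, letter i, o i).

Definition drun (q : nat -> dstate C) (o : nat -> dmove) : Prop :=
  dinitial (q 0) /\ forall i,
    [/\ o i \in moves (q i) (letter i), (o i).1.1 = q i.+1 &
        gkind_sat n (o i).1.2 (clock w (dedge q o) i clk_x)
          (clock w (dedge q o) i clk_y)].

Lemma detector_lang : lang (detector n) w <-> exists q o, drun q o /\
  forall N, exists2 i, N <= i & daccepting (q i).
Proof.
rewrite langE; split=> [[e [e0 he acc]]|[q [o [[q0 hq] acc]]]].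
  have ex i : exists d : dstate C * option C * dmove, [/\ e i = edge n d & d \in dmoves].
    by have [/mapP[d hd ->] _ _ _] := he i; exists d.
  have [d hd] := choice ex.
  have ed i : e i = edge n (d i) by have [] := hd i.
  have dl i : (d i).1.2 = letter i.
    by have [_ _ + _] := he i; rewrite ed label_edge /letter => <-; rewrite enum_rankK.
  have eE : e = dedge (fun i => (d i).1.1) (fun i => (d i).2).
    apply/funext => i; rewrite ed /dedge -dl.
    by case: (d i) => [[q l] o].
  exists (fun i => (d i).1.1), (fun i => (d i).2); split; last first.
    move=> N; have [i Ni] := acc N; rewrite inE ed source_edge enum_rankK => ai.
    by exists i.
  split=> [|i]; first by move: e0; rewrite inE ed source_edge enum_rankK.
  have [_ h2 _ h4] := he i; split.
  - have [_ /allpairsPdep[[q l] [o' [_ ho eq_d]]]] := hd i.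
    by rewrite -dl eq_d.
  - by apply: enum_rank_inj; rewrite -(target_edge n) -(source_edge n) -!ed.
  - by rewrite -gkind_guardP -eE; move: h4; rewrite ed cond_edge.
exists (dedge q o); split.
- by rewrite inE source_edge enum_rankK.
- move=> i; have [h1 h2 h3] := hq i; split.
  + apply/mapP; exists (q i, letter i, o i) => //.
    by apply/allpairsPdep; exists (q i, letter i), (o i); rewrite mem_enum.
  + by rewrite target_edge source_edge /= h2.
  + by rewrite label_edge enum_valK.
  + by rewrite cond_edge gkind_guardP.
- move=> N; have [i Ni ai] := acc N; exists i => //.
  by rewrite inE source_edge enum_rankK.
Qed.

Lemma evtime_lt : {mono evtime : i j / i < j >-> (i < j)%R}.
Proof. by move=> i j; rewrite /evtime after_lt ltnS. Qed.

Lemma evtime_inj : injective evtime.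
Proof. by move=> i j /after_inj[]. Qed.

Lemma clock_once (q : nat -> dstate C) (o : nat -> dmove) x (p i : nat) :
  (forall j : nat, (x \in (o j).2) = (j == p)) -> p < i ->
  clock w (dedge q o) i x = (evtime i - evtime p)%R.
Proof.
move=> ho pi; rewrite /clock (_ : last_reset _ _ _ = Some p) //.
elim: i pi => // i IHi; rewrite ltnS leq_eqVlt => /orP[/eqP<-|pi] /=.
  by rewrite resets_edge ho eqxx.
by rewrite resets_edge ho gtn_eqF // IHi.
Qed.

(** The common shape of the runs using one clock: guess at [p], wait in [X], then conclude at [r],
    or wait forever if [r] is [None]. *)
Lemma accept_wait p X g0 r g :
  (X, KTrue, reset_x) \in moves Main (letter p) ->
  (forall i, p < i -> (if r is Some r' then i < r' else true) ->
    (X, g0, no_reset) \in moves X (letter i) /\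
    forall y, gkind_sat n g0 (evtime i - evtime p)%R y) ->
  (if r is Some r' then
     [/\ p < r', (Acc, g, no_reset) \in moves X (letter r') &
         forall y, gkind_sat n g (evtime r' - evtime p)%R y]
   else daccepting X) ->
  lang (detector n) w.
Proof.
move=> hX hloop hend.
pose past i := if r is Some r' then r' < i else false.
pose now i := if r is Some r' then i == r' else false.
pose q i := if i <= p then Main else if past i then Acc else X.
pose o i : dmove := (q i.+1,
  if i <= p then KTrue else if now i then g else if past i then KTrue else g0,
  if i == p then reset_x else no_reset).
have rx j : (clk_x \in (o j).2) = (j == p) by rewrite /=; case: eqP; rewrite !inE.
apply/detector_lang; exists q, o; split; last first.
  move=> N; exists (N + p.+1 + odflt 0 r); first lia.
  rewrite /q ifN; last lia.
  by rewrite /past; case: (r) hend => [r'|] //=; rewrite ifT //; lia.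
split=> [|i]; first by rewrite /q leq0n /dinitial eqxx.
case: (ltngtP i p) => [ip|pi|->].
- split=> //; last by rewrite /= (ltnW ip).
  by rewrite /q /o /= /q ip (ltnW ip) ltn_eqF // !inE eqxx.
- split=> //; last first.
    rewrite (clock_once q rx pi) /= leqNgt pi /=.
    case: (boolP (now i)) => ni.
      by move: ni hend; rewrite /now; case: (r) => // r' /eqP-> [].
    case: (boolP (past i)) => // npi.
    apply: (hloop i pi _).2; move: ni npi; rewrite /now /past.
    by case: (r) => // r'; lia.
  rewrite /o /q /= [i < p]ltnNge (ltnW pi) [i <= p]leqNgt pi /= gtn_eqF //.
  rewrite /now /past; move: hloop hend; case: (r) => [r'|] hloop hend; last first.
    exact: (hloop i pi isT).1.
  case: (ltngtP i r') => [ir|ri|->].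
  + by rewrite ltnS leqNgt ir /=; exact: (hloop i pi ir).1.
  + by rewrite ltnS (ltnW ri) inE.
  + by rewrite ltnSn; case: hend.
- split=> //; last by rewrite /= leqnn.
  rewrite /o /q /= leqnn ltnn eqxx (_ : past p.+1 = false) //.
  by rewrite /past; case: (r) hend => // r' [h _ _]; lia.
Qed.

Lemma accept_between p r : letter p != None -> p.+1 < r -> ~~ on new (letter r) ->
  (evtime p + 1 < evtime r)%R -> (evtime r < evtime p.+1 + 1)%R ->
  lang (detector n) w.
Proof.
move=> lp pr nr h1 h2.
pose q i := if i <= p then Main else if i == p.+1 then Nxt (letter p)
  else if i <= r then Btw else Acc.
pose o i : dmove := (q i.+1, if i == r then KBetween else KTrue,
  if i == p then reset_x else if i == p.+1 then reset_y else no_reset).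
have rx j : (clk_x \in (o j).2) = (j == p).
  by rewrite /=; case: eqP => [_|_]; last case: eqP => _; rewrite !inE.
have ry j : (clk_y \in (o j).2) = (j == p.+1).
  rewrite /=; case: (eqVneq j p) => [->|_]; last by case: eqP => _; rewrite !inE.
  by rewrite !inE ltn_eqF.
apply/detector_lang; exists q, o; split; last first.
  move=> N; exists (N + r.+1); first lia.
  by rewrite /q !ifN //; lia.
split=> [|i]; first by rewrite /q leq0n /dinitial eqxx.
have sat : gkind_sat n (o i).1.2 (clock w (dedge q o) i clk_x) (clock w (dedge q o) i clk_y).
  rewrite /o /=; case: (eqVneq i r) => // ->.
  rewrite (clock_once q rx) ?(clock_once q ry) //=; last exact: ltnW.
  by rewrite ltrBrDl ltrBlDl h1.
split=> //; rewrite /o /q.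
case: (ltngtP i p) => [ip|pi|->].
- have -> : (i == p.+1) = false by lia.
  have -> : (i == r) = false by lia.
  by rewrite !inE eqxx.
- rewrite eqSS (gtn_eqF pi).
  case: (eqVneq i p.+1) => [->|ip1].
    rewrite (ltn_eqF pr) /moves !mem_cat !mem_opt.
    by rewrite (_ : p.+1 < r) // eqxx lp !orbT.
  case: (ltngtP i r) => [ir|ri|->].
  + by rewrite inE eqxx.
  + by rewrite inE eqxx.
  + by rewrite inE mem_opt nr eqxx orbT.
- rewrite eqxx (ltn_eqF (ltnW pr)) /moves mem_cat !inE eqxx !orbT //.
Qed.

Lemma accept_first : ~~ follows None (letter 0) -> lang (detector n) w.
Proof.
move=> h; pose q i : dstate C := if i == 0 then Nxt None else Acc.
apply/detector_lang; exists q, (fun=> (Acc, KTrue, no_reset)); split.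
  split=> // -[|i]; split=> //; last by rewrite inE.
  by rewrite /moves !mem_cat mem_opt h eqxx.
by move=> N; exists N.+1.
Qed.

Lemma not_good_lang : ~ good n evtime letter -> lang (detector n) w.
Proof.
move=> ng; apply: contrapT => nl; apply: ng; split.
- by apply: contrapT => /negP/accept_first.
- move=> p; apply: contrapT => /negP h; apply: nl.
  apply: (@accept_wait p (Nxt (letter p)) KTrue (Some p.+1) KTrue).
  + by rewrite /moves !mem_cat !inE eqxx !orbT.
  + by move=> i; lia.
  + by split=> //; rewrite /moves !mem_cat mem_opt h eqxx.
- move=> p c lp; apply: contrapT => no; apply: nl.
  have cp : (Cpy c, KTrue, reset_x) \in moves Main (letter p).
    by rewrite lp /moves !mem_cat !inE eqxx !orbT.
  (* Either an event at distance 1 has the wrong content, or there is no such event. *)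
  have [[r pr Tr]|nr] := pselect (exists2 r, p < r & evtime r = (evtime p + 1)%R).
    apply: (accept_wait (r := Some r) (g0 := KNeq1) (g := KEq1) cp) => [i pi ir|].
      split=> [|y]; first by rewrite inE eqxx.
      rewrite /= subr_eq addrC -Tr; apply/eqP => /evtime_inj; lia.
    split=> // [|y]; last by rewrite /= Tr addrAC subrr add0r.
    rewrite inE mem_opt eqxx andbT orbC; apply/orP; left.
    by apply/negP => h; apply: no; exists r.
  apply: (accept_wait (r := None) (g0 := KNeq1) (g := KEq1) cp) => // i pi _.
  split=> [|y]; first by rewrite inE eqxx.
  by rewrite /= subr_eq addrC; apply/eqP => h; apply: nr; exists i.
- move=> p r pr lp h1 h2; apply: contrapT => /negP h; apply: nl.
  exact: accept_between lp pr h h1 h2.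
- move=> p r pr lp lr h; apply: nl.
  apply: (@accept_wait p Awt KTrue (Some r) KEq1).
  + by rewrite lp /moves !mem_cat !inE eqxx !orbT.
  + by move=> i _ _; rewrite inE eqxx.
  + split=> // [|y]; first by rewrite lr inE mem_opt !eqxx orbT.
    by rewrite /= h addrAC subrr add0r.
- move=> p r pr lp lr; apply: contrapT => h; apply: nl.
  apply: (@accept_wait p Ini KTrue (Some r) KNeqN).
  + by rewrite /moves !mem_cat mem_opt lp eqxx !orbT.
  + by move=> i _ _; rewrite inE eqxx.
  + split=> // [|y]; first by rewrite inE mem_cat mem_opt lr eqxx orbT.
    by rewrite /= subr_eq addrC; apply/eqP.
- move=> p r pr lp lr h; apply: nl.
  apply: (@accept_wait p Ini KTrue (Some r) KEqN).
  + by rewrite /moves !mem_cat mem_opt lp eqxx !orbT.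
  + by move=> i _ _; rewrite inE eqxx.
  + split=> // [|y]; first by rewrite inE mem_cat !mem_opt lr eqxx !orbT.
    by rewrite /= h addrAC subrr add0r.
- move=> p lp; apply: contrapT => h; apply: nl.
  apply: (@accept_wait p (Nxt (letter p)) KTrue (Some p.+1) KNeq1).
  + by rewrite /moves !mem_cat !inE eqxx !orbT.
  + by move=> i; lia.
  + split=> // [|y]; first by rewrite /moves !mem_cat !mem_opt lp eqxx !orbT.
    by rewrite /= subr_eq addrC; apply/eqP.
- move=> N; apply: contrapT => no; apply: nl.
  apply: (@accept_wait N Fin KTrue None KTrue) => // [|i Ni _].
    by rewrite /moves !mem_cat !inE eqxx !orbT.
  split=> //; rewrite /moves mem_opt eqxx andbT.
  by apply/negP => h; apply: no; exists i => //; exact: ltnW.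
Qed.

Lemma lang_not_good : lang (detector n) w -> ~ good n evtime letter.
Proof.
move=> /detector_lang[q [o [[q0 hrun] acc]]] G.
pose lr i x := last_reset (dedge q o) i x.
(* The reset of [clk_x] identifies the guessed event. [Acc] is unreachable, as entering it exhibits
   a violation of [G]; only [Fin] and [Cpy] remain to be excluded as recurrent. *)
pose inv i := match q i with
  | Main | Fin => True
  | Acc => False
  | Nxt l0 => if i is j.+1 then letter j = l0 /\ lr i clk_x = Some j else l0 = None
  | Cpy c => exists p, [/\ p < i, letter p = Some c, lr i clk_x = Some p &
      forall r, p < r < i -> evtime r <> (evtime p + 1)%R]
  | Btw => exists p, [/\ p.+1 < i, letter p != None, lr i clk_x = Some p &
      lr i clk_y = Some p.+1]
  | Awt => exists p, [/\ p < i, letter p = None & lr i clk_x = Some p]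
  | Ini => exists p, [/\ p < i, on init (letter p) & lr i clk_x = Some p]
  end.
have clkE i x p : lr i x = Some p -> clock w (dedge q o) i x = (evtime i - evtime p)%R.
  by rewrite /lr /clock => ->.
have lrS i x : lr i.+1 x = if x \in (o i).2 then Some i else lr i x.
  by rewrite /lr /= resets_edge.
have invP i : inv i.
  elim: i => [|i IHi]; rewrite /inv.
    by case/orP: q0 => /eqP ->.
  have [mi qi gi] := hrun i; rewrite -qi lrS lrS.
  move: IHi mi; rewrite /inv; case Eq: (q i) => [||||||l0|c] //=.
  - move=> _; rewrite !inE !mem_cat => /orP[/eqP->//|/orP[/eqP->//|/orP[/eqP->/=|]]].
      by rewrite !inE.
    case/orP; last first.
      rewrite mem_opt => /andP[li /eqP->] /=; rewrite !inE.
      by exists i.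
    case El: (letter i) => [c|]; rewrite inE => /eqP-> /=; rewrite !inE /=.
      by exists i; split=> // r; lia.
    by exists i.
  - move=> [p [pi lp xp yp]]; rewrite inE mem_opt => /orP[/eqP->/=|/andP[nl /eqP eo]].
      by rewrite !inE; exists p; split=> //; lia.
    move: gi; rewrite eo /= (clkE _ _ _ xp) (clkE _ _ _ yp) ltrBrDl ltrBlDl => /andP[g1 g2].
    by move/negP: nl; apply; exact: good_between G _ _ pi lp g1 g2.
  - move=> [p [pi lp xp]]; rewrite inE mem_opt => /orP[/eqP->/=|/andP[/eqP nl /eqP eo]].
      by rewrite !inE; exists p; split=> //; lia.
    move: gi; rewrite eo /= (clkE _ _ _ xp) subr_eq addrC => /eqP.
    exact: good_gap G _ _ pi lp nl.
  - move=> [p [pi lp xp]]; rewrite inE mem_cat !mem_opt.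
    case/orP=> [/eqP->/=|/orP[]/andP[nl /eqP eo]].
    + by rewrite !inE; exists p; split=> //; lia.
    + move: gi; rewrite eo /= (clkE _ _ _ xp) subr_eq addrC => /eqP; apply.
      exact: good_mark G _ _ pi lp nl.
    + move: gi; rewrite eo /= (clkE _ _ _ xp) subr_eq addrC => /eqP.
      exact: good_anti G _ _ pi lp nl.
  - by move=> _; rewrite mem_opt => /andP[_ /eqP->].
  - move=> hi; rewrite !mem_cat !mem_opt => /orP[/andP[nf /eqP eo]|/orP[]/andP[nl /eqP eo]].
    + rewrite eo /=; move/negP: nf; apply; case: (i) hi => [->|j [<- _]].
        exact: good_first G.
      exact: good_next G _.
    + rewrite eo /= !inE /=; case: (i) hi => [l00|j [lj xj]].
        by rewrite l00 in nl.
      by exists j; split=> //; rewrite lj.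
    + move: gi; rewrite eo /=; case: (i) hi => [l00|j [lj xj]]; first by rewrite l00 in nl.
      rewrite (clkE _ _ _ xj) subr_eq addrC => /eqP; apply.
      by apply: (good_init G); rewrite lj.
  - move=> [p [pi lp xp hp]]; rewrite inE mem_opt => /orP[/eqP eo|/andP[nl /eqP eo]].
      rewrite eo /= !inE; exists p; split=> // [|r]; first lia.
      move=> /andP[pr]; rewrite ltnS leq_eqVlt => /orP[/eqP->|ri]; last by apply: hp; rewrite pr.
      by move: gi; rewrite eo /= (clkE _ _ _ xp) subr_eq addrC => /eqP.
    move: gi; rewrite eo /= (clkE _ _ _ xp) subr_eq addrC => /eqP Ti.
    have [r [pr Tr cr]] := good_copy G lp.
    by move/negP: nl; apply; rewrite (_ : i = r) //; apply: evtime_inj; rewrite Ti Tr.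
have fin i : q i = Fin -> forall j, i <= j -> q j = Fin /\ ~~ on sig (letter j).
  move=> qi; have stay j : q j = Fin -> q j.+1 = Fin /\ ~~ on sig (letter j).
    move=> qj; have [+ <- _] := hrun j; rewrite qj /= mem_opt => /andP[h /eqP->].
    by [].
  have all_fin j : i <= j -> q j = Fin.
    move=> /subnKC <-; elim: (j - i) => [|d IHd]; first by rewrite addn0.
    by rewrite addnS; have [] := stay _ IHd.
  by move=> j ij; split; [exact: all_fin|have [] := stay _ (all_fin j ij)].
have [i _ ai] := acc 0; move: ai; case Eq: (q i) => [||||||l0|c] // _.
- by have := invP i; rewrite /inv Eq.
- have [p ip sp] := good_sig G i.
  by have [_ /negP] := fin i Eq p ip.
- have stay j : q j = Cpy c -> q j.+1 = Cpy c /\ (o j).1.2 = KNeq1.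
    move=> qj; have [+ qj1 _] := hrun j; rewrite qj /= inE mem_opt.
    case/orP=> [/eqP eo|/andP[_ /eqP eo]]; first by rewrite -qj1 eo.
    by have := invP j.+1; rewrite /inv -qj1 eo.
  have all_c j : i <= j -> q j = Cpy c.
    move=> /subnKC <-; elim: (j - i) => [|d IHd]; first by rewrite addn0.
    by rewrite addnS; have [] := stay _ IHd.
  have := invP i; rewrite /inv Eq => -[p [pi lp xp hp]].
  have [r [pr Tr cr]] := good_copy G lp.
  have [ri|ir] := ltnP r i; first by apply: (hp r) => //; rewrite pr.
  have xr j : i <= j -> lr j clk_x = Some p.
    move=> /subnKC <-; elim: (j - i) => [|d IHd]; first by rewrite addn0.
    rewrite addnS lrS; have [+ qj1 _] := hrun (i + d).
    rewrite all_c; last exact: leq_addr.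
    rewrite /= inE mem_opt => /orP[/eqP->|/andP[_ /eqP eo]]; first by rewrite !inE.
    by have := invP (i + d).+1; rewrite /inv -qj1 eo.
  have [_ _] := hrun r; have [_ ->] := stay r (all_c r ir).
  by rewrite /= (clkE _ _ _ (xr r ir)) Tr addrAC subrr add0r eqxx.
Qed.

Lemma lang_detector : lang (detector n) w <-> ~ good n evtime letter.
Proof. by split; [exact: lang_not_good|exact: not_good_lang]. Qed.

End Language.
End Detector.

(** * Rows of cells *)

Section Cells.
Variable e : exp.
Notation P := (program e).
Notation init_label := (lbl e).+4.

Definition ireg (i : instr) : nat :=
  match i with IInc r _ | IDec r _ _ | IQry r _ _ => r | IInit => 0 end.

Definition bnd := size P + \max_(i <- P) ireg i.

Lemma ireg_bnd q : q < size P -> ireg (nth IInit P q) < bnd.+1.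
Proof.
move=> qP; rewrite ltnS /bnd; apply: leq_trans (leq_addl _ _).
elim: (P : seq instr) q qP => // i s IHs [_|q /IHs h]; rewrite big_cons leq_max.
  by rewrite leqnn.
by rewrite h orbT.
Qed.

(* A cell of a row records whether it is the first and the last one of its row,
   the value of the oracle at its index, the control state, and the comparison
   of its index with each register: 2, 1 or 0 when the index is smaller than,
   equal to or larger than the register. *)
Definition cell := (bool * bool * bool * 'I_bnd.+1 * {ffun 'I_bnd.+1 -> 'I_3})%type.

Definition cstart (c : cell) : bool := c.1.1.1.1.
Definition clast (c : cell) : bool := c.1.1.1.2.
Definition corc (c : cell) : bool := c.1.1.2.
Definition cstate (c : cell) : nat := c.1.2.
Definition creg (c : cell) (r : nat) : nat := c.2 (inord r).

Definition trit (x i : nat) : nat := minn 2 (x.+1 - i).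

Variant action := Keep | Up | Down.

Definition iaction (i : instr) (r : nat) : action :=
  match i with
  | IInc r0 _ => if r == r0 then Up else Keep
  | IDec r0 _ _ => if r == r0 then Down else Keep
  | IQry _ _ _ => Keep
  | IInit => if r == 0 then Up else Keep
  end.

Definition act (a : action) (x : nat) : nat :=
  match a with Keep => x | Up => x.+1 | Down => x.-1 end.

(** Along a row a register reads as a block of 2, a single 1, then 0. *)
Definition trit_next (t t' : nat) : bool := if t == 2 then 0 < t' else t' == 0.

(** The term in [start] covers the decrement of 0, where the value 1 at index 0 must persist. *)
Definition trit_copy (a : action) (start : bool) (t t' : nat) : bool :=
  match a with
  | Keep => t' == t
  | Up => if t == 0 then t' < 2 else t' == 2
  | Down => if t == 2 then 0 < t' else t' == start && (t == 1)
  end.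

(** The zero test is read at index 0, the oracle at the index equal to the register; [cnext] spreads
    the resulting label over the row. *)
Definition state_copy (i : instr) (c d : cell) : bool :=
  match i with
  | IInc _ q => cstate d == q
  | IDec r q1 q0 => cstart c ==> (cstate d == if creg c r == 1 then q0 else q1)
  | IQry r q1 q0 => (creg c r == 1) ==> (cstate d == if corc c then q1 else q0)
  | IInit => (cstate d == cstate c) || (cstate d == 0)
  end.

Definition cnext (c d : cell) : bool :=
  if clast c then cstart d
  else [&& ~~ cstart d, cstate d == cstate c &
    [forall r : 'I_bnd.+1, trit_next (creg c r) (creg d r)]].

Definition ccopy (c d : cell) : bool :=
  let i := nth IInit P (cstate c) in
  [&& cstart d == cstart c, ~~ clast d, corc d == corc c, state_copy i c d &
    [forall r : 'I_bnd.+1, trit_copy (iaction i r) (cstart c) (creg c r) (creg d r)]].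

Definition cnew (c : cell) : bool :=
  [&& clast c, ~~ cstart c & [forall r : 'I_bnd.+1, creg c r <= 1]].

Definition cinit (c : cell) : bool :=
  [&& cstart c, clast c, cstate c == init_label &
    [forall r : 'I_bnd.+1, creg c r == 1]].

(** The address 0 may start a row only at time [n.+1] after the first cell, and the initial label
    may not start one then: together they fix the length of the initial phase. *)
Definition cmark (c : cell) : bool := cstart c && (cstate c == 0).
Definition canti (c : cell) : bool := cstart c && (cstate c == init_label).
Definition csig (c : cell) : bool := cstate c == (lbl e).+2.

Definition enc (W : pred nat) (cf : config) (j i : nat) : cell :=
  (i == 0, i == j, W i, inord cf.1,
   [ffun r : 'I_bnd.+1 => inord (trit (cf.2 r) i)]).

Lemma creg_enc W cf j i r : r < bnd.+1 -> creg (enc W cf j i) r = trit (cf.2 r) i.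
Proof. by move=> rb; rewrite /creg ffunE inordK ?inordK // /trit; lia. Qed.

Lemma label_bnd q : q < init_label.+1 -> q < bnd.+1.
Proof. by rewrite -size_program /bnd; lia. Qed.

Lemma cstate_enc n W j j' i :
  cstate (enc W (conf e n W j) j' i) = (conf e n W j).1.
Proof. by rewrite /cstate inordK //; apply/label_bnd/conf_label_lt. Qed.

Definition label_step (i : instr) (W : pred nat) (cf : config) (q : nat) : Prop :=
  match i with
  | IInc _ q1 => q = q1
  | IDec r q1 q0 => q = if cf.2 r == 0 then q0 else q1
  | IQry r q1 q0 => q = if W (cf.2 r) then q1 else q0
  | IInit => q = cf.1 \/ q = 0
  end.

Lemma nth_init : nth IInit P init_label = IInit.
Proof. by have := program_tail e 4; rewrite addnC. Qed.

(** Seen as an instruction that increments register 0, the initial phase obeys the same local rules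
    as the program; its choice to stay or to start makes [label_step] a relation. *)
Lemma conf_succ n W j :
  let cf := conf e n W j in let i := nth IInit P cf.1 in
  label_step i W cf (conf e n W j.+1).1 /\
  forall r, (conf e n W j.+1).2 r = act (iaction i r) (cf.2 r).
Proof.
case: (ltngtP j n) => [jn|nj|->] /=.
- rewrite !conf_init //; last exact: ltnW.
  rewrite nth_init /=; split; first by left.
  by move=> r; rewrite /upd; case: eqP.
- rewrite conf_step //.
  have : targets_in (fun q => 0 < q < init_label) (nth IInit P (conf e n W j).1).
    apply: program_targets; case: (ltngtP j n.+1) => [|h|->]; first lia.
      by have /andP[] := conf_label e W h.
    by rewrite conf_start.
  case: (conf e n W j) => q s; rewrite stepE /=.
  case: nth => [r0 q1|r0 q1 q2|r0 q1 q2|] //= _; split=> // r; rewrite /upd;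
    by case: eqP => [->|].
- rewrite conf_start conf_init // nth_init /=; split; first by right.
  by move=> r; rewrite /upd; case: eqP.
Qed.

Lemma enc_next n W j i : i < j ->
  cnext (enc W (conf e n W j) j i) (enc W (conf e n W j) j i.+1).
Proof.
move=> ij; rewrite /cnext /= (_ : clast _ = false); last by rewrite /clast /= ltn_eqF.
rewrite !cstate_enc eqxx /=; apply/forallP => r.
by rewrite !creg_enc // /trit_next /trit; case: eqP; lia.
Qed.

Lemma enc_copy n W j i : i <= j ->
  ccopy (enc W (conf e n W j) j i) (enc W (conf e n W j.+1) j.+1 i).
Proof.
move=> ij; have [hl hr] := conf_succ n W j; rewrite /ccopy !cstate_enc.
set I := nth _ _ _ in hl hr *.
have rI : ireg I < bnd.+1 by apply: ireg_bnd; rewrite size_program conf_label_lt.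
apply/and5P; split=> //; first by rewrite /clast /=; lia.
  case: I hl rI {hr} => [r q|r q1 q0|r q1 q0|] hl rI; rewrite /state_copy ?cstate_enc.
  - by apply/eqP.
  - apply/implyP => /eqP i0; rewrite i0 creg_enc // hl /trit; apply/eqP.
    by congr (if _ then _ else _); lia.
  - rewrite creg_enc //; apply/implyP => ti.
    have -> : corc (enc W (conf e n W j) j i) = W ((conf e n W j).2 r).
      by rewrite /corc /=; congr W; move: ti; rewrite /trit; lia.
    by apply/eqP.
  - by case: hl => ->; rewrite eqxx ?orbT.
apply/forallP => r; rewrite !creg_enc // hr /trit /cstart /=.
by case: (iaction I r) => /=; [|case: eqP|case: eqP]; do ?case: eqP => /=; lia.
Qed.

(** Copying leaves a choice between 0 and 1 above an incremented register and between 1 and 2 below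
    a decremented one. The shape of the row and the bound on its last cell resolve it. *)
Lemma trit_row (a : action) (x j : nat) (t : nat -> nat) : x <= j ->
  (forall i, i <= j.+1 -> t i <= 2) ->
  (forall i, i <= j -> trit_copy a (i == 0) (trit x i) (t i)) ->
  (forall i, i <= j -> trit_next (t i) (t i.+1)) -> t j.+1 <= 1 ->
  forall i, i <= j.+1 -> t i = trit (act a x) i.
Proof.
move=> xj t2 hV hN tl i ij.
have nextP i' : i' <= j ->
    t i' = 2 /\ 0 < t i'.+1 \/ t i' <> 2 /\ t i'.+1 = 0.
  by move=> /hN; rewrite /trit_next; case: eqP => h h'; [left|right; split=> //; apply/eqP].
have N0 := nextP i.
have N1 : 0 < i -> t i.-1 = 2 /\ 0 < t i \/ t i.-1 <> 2 /\ t i = 0.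
  by move=> i0; have := nextP i.-1; rewrite prednK //; apply; lia.
have ti := t2 i ij.
have e0 : i = j.+1 -> t i <= 1 by move=> ->.
have e1 : i = j -> t i.+1 <= 1 by move=> ->.
move: hV; rewrite /trit_copy /trit; case: a => /= hV.
- have V0 : i <= j -> t i = minn 2 (x.+1 - i) by move=> /hV/eqP.
  have V2 : i.-1 <= j -> t i.-1 = minn 2 (x.+1 - i.-1) by move=> /hV/eqP.
  by clear -xj ij N0 N1 ti e0 e1 V0 V2; lia.
- have copyP i' : i' <= j -> x < i' /\ t i' < 2 \/ i' <= x /\ t i' = 2.
    move=> /hV; case: eqP => h h'; first by left; lia.
    by right; split; [lia|exact/eqP].
  have V0 := copyP i; have V2 := copyP i.-1.
  by clear -xj ij N0 N1 ti e0 e1 V0 V2; lia.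
- move: N0 N1 => {nextP e0 e1 hN t2 tl} N0 N1.
  have copy_lt i' : i' < x -> 0 < t i'.
    move=> i'x; have := hV i'; clear -xj i'x => hV.
    by have := hV ltac:(lia); rewrite ifT //; lia.
  have copy_ge i' : x <= i' -> i' <= j -> t i' = (i' == 0).
    move=> xi' /hV; clear -xi'; rewrite ifN; last lia.
    move=> /eqP ->; case: eqP => //= i0; move: xi'.
    by rewrite i0 leqn0 => /eqP ->.
  case: (ltnP i x) => [ix|xi].
    have ij' : i <= j by clear -ix xj; lia.
    have {}N0 := N0 ij'; have t0 := copy_lt _ ix.
    case: (ltnP i.+1 x) => [/[dup] ix1 /copy_lt t1|xi1].
      by clear -ix1 t1 N0; lia.
    have t1 := copy_ge _ xi1 ltac:(clear -ix xj; lia).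
    by clear -ix xi1 t0 t1 ti N0; lia.
  case: (leqP i j) => [ij'|ji]; first by rewrite copy_ge //; clear -xi; lia.
  have {}N1 := N1 ltac:(clear -ji; lia).
  have t1 := copy_ge i.-1 ltac:(clear -xj ji; lia) ltac:(clear -ij; lia).
  by clear -xi xj ji N1 t1; lia.
Qed.

(** * From a well-formed sequence of cells to a recurrent run *)

Section Decode.
Variables (R : realType) (n : nat) (T : nat -> R) (c : nat -> cell).
Hypothesis T_lt : {mono T : i j / i < j >-> (i < j)%R}.
Hypothesis G : good_cells cnext ccopy cnew cinit cmark canti csig n T c.

Fixpoint tri (j : nat) : nat := if j is i.+1 then tri i + j else 0.

Notation idx j i := (tri j + i).

Definition copy_of p q := (T q = T p + 1)%R /\ ccopy (c p) (c q).

Lemma T_inj : injective T.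
Proof.
by move=> p q h; case: (ltngtP p q) => //; rewrite -T_lt h ltxx.
Qed.

(** Cells strictly between the two copies are new, hence last but not first in their row, so at most
    one fits; as a copy is never last, the cell after [q] is either the next copy or one new cell
    ending the row. *)
Lemma copy_next p q : copy_of p q ->
  if cstart (c p.+1) then cnew (c q.+1) /\ copy_of p.+1 q.+2
  else copy_of p.+1 q.+1.
Proof.
move=> [Tq /and5P[/eqP sq nl _ _ _]].
have pq : p < q by rewrite -T_lt Tq ltrDl.
have [r [pr Tr cr]] := cells_copy G p.+1.
have qr : q < r by rewrite -T_lt Tq Tr ltrD2r T_lt.
have between s : q < s < r -> cnew (c s).
  move=> /andP[qs sr]; apply: (cells_between G (p := p)); first lia.
    by rewrite -Tq T_lt.
  by rewrite -Tr T_lt.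
have start_r : cstart (c r) = cstart (c p.+1) by case/and5P: cr => /eqP.
have next_q : ~~ cstart (c q.+1).
  by have := cells_next G q; rewrite /cnext (negPf nl) => /and3P[].
case: (eqVneq r q.+1) => [rq|nrq].
  by rewrite -start_r rq (negPf next_q) -rq.
have new1 : cnew (c q.+1) by apply: between; lia.
have start2 : cstart (c q.+2).
  by have := cells_next G q.+1; rewrite /cnext; case/and3P: new1 => ->.
case: (eqVneq r q.+2) => [rq|nrq2].
  by rewrite -start_r rq start2; split=> //; split; rewrite -rq.
have /and3P[_ /negP []] : cnew (c q.+2) by apply: between; lia.
by [].
Qed.

Lemma rows j : (forall i, i <= j ->
    [/\ cstart (c (idx j i)) = (i == 0), clast (c (idx j i)) = (i == j) &
        copy_of (idx j i) (idx j.+1 i)]) /\ cnew (c (idx j.+1 j.+1)).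
Proof.
have idxS i k : (idx i k).+1 = idx i k.+1 by rewrite addnS.
have idx_end i : (idx i i).+1 = idx i.+1 0 by rewrite /= addn0 addnS.
suff row i : (forall k, k <= i -> cstart (c (idx i k)) = (k == 0) /\
      clast (c (idx i k)) = (k == i)) -> copy_of (idx i 0) (idx i.+1 0) ->
    (forall k, k <= i -> copy_of (idx i k) (idx i.+1 k)) /\
    cnew (c (idx i.+1 i.+1)) /\ copy_of (idx i.+1 0) (idx i.+2 0).
  have flags i : (forall k, k <= i -> cstart (c (idx i k)) = (k == 0) /\
      clast (c (idx i k)) = (k == i)) /\ copy_of (idx i 0) (idx i.+1 0).
    elim: i => [|i [IH1 IH2]].
      have /and4P[s0 l0 _ _] := cells_first G; split.
        by move=> k; rewrite leqn0 => /eqP ->; rewrite s0 l0.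
      have [r [_ Tr cr]] := cells_copy G 0.
      (* [cells_between] says nothing about events before the first copy; [cells_init] makes the
         event 1 that copy. *)
      have r1 : r = 1 by apply: T_inj; rewrite Tr (cells_init G) // (cells_first G).
      by have : copy_of 0 1 by rewrite -r1; split.
    have [cp [nw cp1]] := row i IH1 IH2; split=> // k.
    rewrite leq_eqVlt => /orP[/eqP->|ki].
      by case/and3P: nw => -> /negPf -> _; rewrite eqxx.
    have [_ /and5P[/eqP-> /negPf-> _ _ _]] := cp k ki.
    by have [-> _] := IH1 k ki; rewrite (ltn_eqF ki).
  have [h1 h2] := flags j; have [h3 [h4 _]] := row j h1 h2.
  by split=> // i ij; have [s l] := h1 i ij; split=> //; apply: h3.
move=> flags first.
have cp k : k <= i -> copy_of (idx i k) (idx i.+1 k).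
  elim: k => // k IHk ki; have := copy_next (IHk (ltnW ki)).
  by rewrite !idxS; have [-> _] := flags k.+1 ki.
split=> //; have := copy_next (cp i (leqnn i)).
have start1 : cstart (c (idx i i).+1).
  have := cells_next G (idx i i); rewrite /cnext.
  by have [_ ->] := flags i (leqnn i); rewrite eqxx.
by rewrite start1 (idx_end i) (idxS i.+1 i) (idx_end i.+1).
Qed.

Lemma rows_time j : (T (idx j 0) = T 0 + j%:R)%R.
Proof.
elim: j => [|j IHj]; first by rewrite addr0.
have [/(_ 0 (leq0n j))[_ _ [-> _]] _] := rows j.
by rewrite IHj -addrA -natr1.
Qed.

(** The bit [i] is read where it first appears, in the last cell of row [i]. *)
Definition decoded_oracle : pred nat := fun i => corc (c (idx i i)).
Notation W := decoded_oracle.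

Lemma decoded_row j i : i <= j ->
  [/\ cstate (c (idx j i)) = (conf e n W j).1, corc (c (idx j i)) = W i &
      forall r, r < bnd.+1 -> creg (c (idx j i)) r = trit ((conf e n W j).2 r) i].
Proof.
elim: j i => [|j IHj] i.
  rewrite leqn0 => /eqP ->; have /and4P[_ _ /eqP h /forallP hr] := cells_first G.
  rewrite conf_init //; split=> // r rb; have := hr (Ordinal rb).
  by rewrite /= /upd if_same => /eqP.
have [row new] := rows j; have [row1 _] := rows j.+1.
have [hl hr] := conf_succ n W j.
have cstateE k : k <= j -> cstate (c (idx j k)) = (conf e n W j).1 by case/IHj.
set I := nth _ _ _ in hl hr.
have rI : ireg I < bnd.+1 by apply: ireg_bnd; rewrite size_program conf_label_lt.
have cp k : k <= j -> [/\ corc (c (idx j.+1 k)) = corc (c (idx j k)),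
    state_copy I (c (idx j k)) (c (idx j.+1 k)) &
    forall r, r < bnd.+1 -> trit_copy (iaction I r) (k == 0)
      (trit ((conf e n W j).2 r) k) (creg (c (idx j.+1 k)) r)].
  move=> kj; have [s _ [_ /and5P[_ _ /eqP o]]] := row k kj.
  rewrite cstateE // -/I => hs /forallP ht; split=> // r rb.
  have [_ _ <- //] := IHj k kj.
  by rewrite -s; exact: (ht (Ordinal rb)).
have nx k : k <= j -> cstate (c (idx j.+1 k.+1)) = cstate (c (idx j.+1 k)) /\
    forall r, r < bnd.+1 -> trit_next (creg (c (idx j.+1 k)) r) (creg (c (idx j.+1 k.+1)) r).
  move=> kj; have := cells_next G (idx j.+1 k); rewrite /cnext -addnS.
  have [_ -> _] := row1 k (leqW kj); rewrite ltn_eqF // => /and3P[_ /eqP -> /forallP ht].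
  by split=> // r rb; exact: (ht (Ordinal rb)).
have st k : k <= j.+1 -> cstate (c (idx j.+1 k)) = cstate (c (idx j.+1 0)).
  by elim: k => // k IHk kj; have [-> _] := nx k kj; apply: IHk; exact: ltnW.
have [start0 _ _] := row1 0 (leq0n _).
have label : cstate (c (idx j.+1 0)) = (conf e n W j.+1).1.
  case EI : I hl rI cp => [r q|r q1 q0|r q1 q0|] hl rI cp.
  - by have [_ /eqP -> _] := cp 0 (leq0n j); rewrite hl.
  - have [_ + _] := cp 0 (leq0n j); have [s _ _] := row 0 (leq0n j).
    have [_ _ tr] := IHj 0 (leq0n j).
    rewrite /= s /= tr // hl => /eqP ->.
    by congr (if _ then _ else _); rewrite /trit; lia.
  - have xj := conf_reg e n W j r.
    have [_ + _] := cp _ xj; have [_ o tr] := IHj _ xj.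
    rewrite /= tr // o hl (_ : trit _ _ = 1) => [/eqP <-|]; last by rewrite /trit; lia.
    by rewrite (st _ (leqW xj)).
  (* Running labels never carry [IInit], so row [j] is initial; [canti] then forbids staying when
     [j = n], and [cmark] forbids starting earlier. *)
  - have jn : j <= n.
      rewrite leqNgt; apply/negP => nj.
      have : targets_in (fun q => 0 < q < init_label) I.
        apply: program_targets; case: (ltngtP j n.+1) => [|h|->]; first lia.
          by have /andP[] := conf_label e W h.
        by rewrite conf_start.
      by rewrite EI.
    have [_ + _] := cp 0 (leq0n j); rewrite /= cstateE // conf_init //=.
    have time := rows_time j.+1; have i0 := cells_first G.
    have pos : 0 < idx j.+1 0 by rewrite /=; lia.
    case/orP=> /eqP q'.
    + have : canti (c (idx j.+1 0)) by rewrite /canti start0 q' !eqxx.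
      move=> /(cells_anti G pos i0); rewrite time => neq.
      have {}jn : j < n by rewrite ltn_neqAle jn andbT; apply/eqP => jn'; apply: neq; rewrite jn'.
      by rewrite q' conf_init.
    + have : cmark (c (idx j.+1 0)) by rewrite /cmark start0 q' !eqxx.
      move=> /(cells_mark G pos i0); rewrite time => /addrI/eqP.
      by rewrite eqr_nat eqSS q' => /eqP ->; rewrite conf_start.
move=> ij; split.
- by rewrite st.
- move: ij; rewrite leq_eqVlt => /orP[/eqP-> //|ij].
  by have [-> _ _] := cp i ij; have [_ -> _] := IHj i ij.
- move=> r rb; rewrite hr; apply: (@trit_row _ _ j (fun k => creg (c (idx j.+1 k)) r) _ _ _ _ _ i ij).
  + exact: conf_reg.
  + by move=> k _; rewrite /creg -ltnS ltn_ord.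
  + by move=> k kj; have [_ _] := cp k kj; apply.
  + by move=> k kj; have [_] := nx k kj; apply.
  + by have /and3P[_ _ /forallP/(_ (Ordinal rb))] := new.
Qed.

Lemma decoded_recurrent N : exists2 j, N <= j & (conf e n W j).1 = (lbl e).+2.
Proof.
have [p Np /eqP sp] := cells_sig G (tri N).
suff [j [i [ij pij]]] : exists j i, i <= j /\ p = idx j i.
  exists j; last by have [<- _ _] := decoded_row ij; rewrite -pij.
  rewrite leqNgt; apply/negP => jN; move: Np; rewrite pij.
  suff : tri j.+1 <= tri N by rewrite /=; lia.
  rewrite -(subnKC jN); elim: (N - j.+1) => [|d IHd]; first by rewrite addn0.
  by rewrite addnS; apply: leq_trans IHd (leq_addr _ _).
elim: p {Np sp} => [|p [j [i [ij ->]]]]; first by exists 0, 0.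
move: ij; rewrite leq_eqVlt => /orP[/eqP->|ij].
  by exists j.+1, 0; split=> //=; lia.
by exists j, i.+1; split=> //; rewrite addnS.
Qed.

End Decode.
End Cells.

(** * The reduction *)

Section Encode.
Variables (R : realType) (e : exp).
Local Open Scope ring_scope.

Fixpoint pos (p : nat) : nat * nat :=
  if p is q.+1 then
    let: (j, i) := pos q in if i == j then (j.+1, 0%N) else (j, i.+1)
  else (0%N, 0%N).

Lemma pos_le p : ((pos p).2 <= (pos p).1)%N.
Proof.
elim: p => //= p; case: (pos p) => j i /=; case: eqP => //=.
by move=> /eqP ij le_ij; rewrite ltn_neqAle ij.
Qed.

Lemma pos_idx j i : (i <= j)%N -> pos (tri j + i) = (j, i).
Proof.
elim: j i => [|j IHj]; first by move=> i; rewrite leqn0 => /eqP ->.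
elim=> [_|i IHi ij]; last by rewrite addnS /= IHi ?ltn_eqF // ltnW.
by rewrite [tri _]/= addn0 addnS [pos _]/= IHj // eqxx.
Qed.

(** A position independent of the row, increasing within the unit interval: equal indices are at
    exact unit distances although rows grow without bound. *)
Definition offset (i : nat) : R := 1 - i.+1%:R^-1.

Lemma offset_lt : {mono offset : i j / (i < j)%N >-> i < j}.
Proof. by move=> i j; rewrite ltrD2l ltrN2 ltf_pV2 ?posrE ?ltr0n // ltr_nat ltnS. Qed.

Lemma offset0 : offset 0 = 0.
Proof. by rewrite /offset invr1 subrr. Qed.

Lemma offset_bound i : 0 <= offset i < 1.
Proof.
rewrite subr_ge0 invf_le1 ?ltr0n // ler1n /=.
by rewrite ltrBlDr ltrDl invr_gt0 ltr0n.
Qed.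

Definition cell_time (p : nat) : R := (pos p).1.+1%:R + offset (pos p).2.

Lemma cell_time_ltS p : cell_time p < cell_time p.+1.
Proof.
rewrite /cell_time /=; case: (pos p) => j i; case: eqP => /= _.
  rewrite offset0 addr0 -[j.+2%:R]natr1 ltrD2l.
  by case/andP: (offset_bound i).
by rewrite ltrD2l offset_lt.
Qed.

Lemma cell_time_lt : {mono cell_time : p q / (p < q)%N >-> p < q}.
Proof.
apply: leW_mono; apply: le_mono => p q; rewrite ltEnat /=.
elim: q => // q IHq; rewrite ltnS leq_eqVlt => /orP[/eqP->|/IHq h].
  exact: cell_time_ltS.
exact: lt_trans h (cell_time_ltS q).
Qed.

Lemma word_of_times k (T : nat -> R) (l : nat -> 'I_k) : 0 < T 0%N ->
  (forall p, T p < T p.+1) ->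
  exists w : timed_word R k, forall p, after w p.+1 = T p /\ (w p).2 = l p.
Proof.
move=> T0 TS.
have ex p : exists d : {posnum R}, d%:num = T p - (if p is q.+1 then T q else 0).
  have h : 0 < T p - (if p is q.+1 then T q else 0).
    by case: p => [|p]; rewrite ?subr0 // subr_gt0.
  by exists (PosNum h).
have [d hd] := choice ex.
exists (fun p => (d p, l p)) => p; split=> //.
elim: p => [|p IHp]; first by rewrite afterS after0 /= hd subr0 add0r.
by rewrite afterS IHp /= hd addrC subrK.
Qed.

Variables (n : nat) (W : pred nat) (b : R).
Hypothesis rec : forall N, exists2 j, (N <= j)%N & (conf e n W j).1 = (lbl e).+2.

Definition encoded (p : nat) : cell e :=
  enc e W (conf e n W (pos p).1) (pos p).1 (pos p).2.

Lemma cinit_encoded p : cinit (encoded p) -> pos p = (0%N, 0%N).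
Proof.
case/and4P; rewrite /cstart /clast /encoded /=.
by case: (pos p) => j i /= /eqP -> /eqP ->.
Qed.

Lemma encoded_good : good_cells (@cnext e) (@ccopy e) (@cnew e) (@cinit e) (@cmark e)
  (@canti e) (@csig e) n (fun p => b + cell_time p) encoded.
Proof.
split.
- apply/and4P; split=> //; first by rewrite /encoded cstate_enc conf_init.
  by apply/forallP => r; rewrite creg_enc // conf_init //= /upd if_same.
- move=> p; have := pos_le p; rewrite /encoded /=; case: (pos p) => j i /= ij.
  case: (eqVneq i j) => [->|nij] /=; first by rewrite /cnext /clast /= eqxx.
  by apply: enc_next; rewrite ltn_neqAle nij.
- move=> p; set j := (pos p).1; set i := (pos p).2.
  have pq : pos (tri j.+1 + i) = (j.+1, i) by apply: pos_idx; exact: leqW (pos_le p).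
  have Tq : b + cell_time (tri j.+1 + i) = b + cell_time p + 1.
    by rewrite /cell_time pq /= -/j -/i -[j.+2%:R]natr1; lra.
  exists (tri j.+1 + i)%N; split=> //.
    by rewrite -cell_time_lt -(ltrD2l b) Tq ltrDl.
  by rewrite /encoded pq /=; exact: enc_copy (pos_le p).
(* The bounds put [q] in the row after that of [p], at a larger index. If [p] did not end its row,
   this index would lie strictly between two consecutive ones; so [p] ends its row and [q] is the
   appended cell. *)
- move=> p q _ h1 h2.
  have {}h1 : cell_time p + 1 < cell_time q by lra.
  have {}h2 : cell_time q < cell_time p.+1 + 1 by lra.
  have := pos_le p; have := pos_le q; move: h1 h2; rewrite /encoded /cell_time /=.
  case: (pos p) => j i; case: (pos q) => j' i' /= h1 h2 ij' ij.
  have /andP[o1 o2] := offset_bound i; have /andP[o3 o4] := offset_bound i'.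
  have lej : (j < j')%N.
    by rewrite -(ltr_nat R); move: h1; rewrite -[j.+1%:R]natr1 -[j'.+1%:R]natr1; lra.
  have gej : (j' <= j.+1)%N.
    rewrite -ltnS -(ltr_nat R).
    move: h2; case: eqP => /= _; first by rewrite offset0 -!natr1; lra.
    have /andP[o5 o6] := offset_bound i.+1.
    by rewrite -!natr1; lra.
  have ej : j' = j.+1 by apply/eqP; rewrite eqn_leq gej.
  have ii' : (i < i')%N.
    rewrite -offset_lt; move: h1; rewrite ej -[j.+2%:R]natr1; lra.
  have eij : i = j.
    apply/eqP; apply: contraT => nij.
    have : offset i' < offset i.+1.
      by move: h2; rewrite (negPf nij) /= ej -[j.+2%:R]natr1; lra.
    by rewrite offset_lt ltnS leqNgt ii'.
  have ei' : i' = j'.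
    by apply/eqP; rewrite eqn_leq ij' ej -eij.
  apply/and3P; split.
  + by rewrite /clast /= ei' eqxx.
  + by rewrite /cstart /= -lt0n (leq_ltn_trans _ ii').
  + apply/forallP => r; rewrite creg_enc // ei'.
    by have := conf_reg e n W j' r; rewrite /trit; lia.
- move=> p q pq /cinit_encoded hp /andP[]; rewrite /encoded cstate_enc /cstart /=.
  case hq: (pos q) => [j i] /= /eqP i0 /eqP cj.
  have -> : b + cell_time q = b + j.+1%:R by rewrite /cell_time hq i0 /= offset0 addr0.
  rewrite /cell_time hp /= offset0 addr0 -addrA -natrD add1n; congr (b + _.+1%:R).
  have [jn|nj] := leqP j n; first by rewrite conf_init in cj.
  apply/eqP; rewrite eqn_leq nj andbT leqNgt; apply/negP => h.
  by have := conf_label e W h; rewrite cj.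
- move=> p q pq /cinit_encoded hp /andP[]; rewrite /encoded cstate_enc /cstart /=.
  case hq: (pos q) => [j i] /= /eqP i0 /eqP cj.
  have -> : b + cell_time q = b + j.+1%:R by rewrite /cell_time hq i0 /= offset0 addr0.
  rewrite /cell_time hp /= offset0 addr0 -addrA -natrD add1n => /addrI/eqP.
  rewrite eqr_nat eqSS => /eqP ej.
  by move: cj; rewrite ej conf_start.
- move=> p /cinit_encoded hp; rewrite /cell_time /= hp /= offset0 !addr0.
  by rewrite -[2%:R]natr1 addrA.
- move=> N; have [j Nj cj] := rec N; exists (tri j).
    by apply: leq_trans Nj _; elim: (j) => // i IHi /=; lia.
  by have := pos_idx (leq0n j); rewrite addn0 /csig /encoded => -> /=; rewrite cstate_enc cj.
Qed.

End Encode.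

Section Universal.
Variables (R : realType) (k : nat).

Definition universal_tba : tba k := @TBA k 1 0 [set: 'I_1]%SET [set: 'I_1]%SET
  [seq Transition ord0 l GTrue finset.set0 ord0 | l <- enum 'I_k].

Lemma lang_universal : lang universal_tba = [set: timed_word R k].
Proof.
apply/funext => w; apply/propext; split=> // _; apply/langE.
exists (fun i => Transition ord0 (w i).2 GTrue finset.set0 ord0 : transition k 1 0).
split=> [|i|N]; first by rewrite inE.
  by split=> //; apply/mapP; exists (w i).2; rewrite ?mem_enum.
by exists N => //; rewrite inE.
Qed.

Lemma universal_deterministic : deterministic R universal_tba.
Proof.
split; first by rewrite cardsT card_ord.
by move=> f g /mapP[a _ ->] /mapP[b _ ->] + _ /= ab; rewrite ab.
Qed.

Definition empty_tba : tba k := @TBA k 1 0 finset.set0 finset.set0 [::].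

Lemma lang_empty : lang empty_tba = set0 :> set (timed_word R k).
Proof.
by apply/funext => w; apply/propext; split=> // /langE[f []]; rewrite inE.
Qed.

End Universal.

Definition reduction (p : form) (n : nat) : tba (nletters (cell (checker p))) :=
  detector (@cnext (checker p)) (@ccopy (checker p)) (@cnew (checker p))
    (@cinit (checker p)) (@cmark (checker p)) (@canti (checker p))
    (@csig (checker p)) n.

Lemma computable_reduction p :
  computable (fun n => tba_code (existT _ _ (reduction p n))).
Proof. exact: computable_detector. Qed.

Section Reduction.
Variables (R : realType) (B : set nat) (p : form).
Hypothesis arith_p : arithmetical p.
Hypothesis B_p : forall n, B n <-> forall E, holds (scons n (fun=> 0)) E p.

Let e := checker p.
Let reduce := reduction p.

Lemma not_B_recurrent n : ~ B n <-> exists W, forall N,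
  exists2 j, N <= j & (conf e n W j).1 = (lbl e).+2.
Proof.
have rc W : (forall N, exists2 j, N <= j & (conf e n W j).1 = (lbl e).+2) <->
    forall m, exists y, checks W p n m y.
  by apply: recurrentP => rho rho0; rewrite eval_checker rho0.
rewrite B_p; transitivity (exists E, ~ holds (scons n (fun=> 0)) E p).
  by split=> [/existsNP|[E hE] h]; [|apply: hE].
by rewrite checksP //; split=> -[W /rc hW]; exists W.
Qed.

Lemma reduce_universal n : B n -> lang (reduce n) = [set: timed_word R _].
Proof.
move=> Bn; apply/funext => w; apply/propext; split=> // _.
apply/lang_detector => /good_cells_of_good[p0 [c G]].
suff : ~ B n by [].
apply/not_B_recurrent; exists (decoded_oracle c) => N.
apply: (decoded_recurrent _ G) => i j; by rewrite evtime_lt ltn_add2l.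
Qed.

(** One tail [u] serves after every block, since [encoded_good] holds for any shift [b], here the
    end of the block. *)
Lemma reduce_unit_gap n : ~ B n -> exists u : timed_word R (nletters (cell e)),
  forall (w : timed_word R (nletters (cell e))) L,
  (forall q, q < L -> (w q).2 = enum_rank (None : option (cell e))) ->
  (forall q, w (L + q) = u q) ->
  lang (reduce n) w <->
  exists q r, (q < r < L) /\ (after w r.+1 = after w q.+1 + 1)%R.
Proof.
move=> /not_B_recurrent[W rec].
have T0 : (0 < cell_time R 0)%R by rewrite /cell_time /= offset0 addr0.
have [u hu] := word_of_times (fun q => enum_rank (Some (encoded e n W q))) T0
  (@cell_time_ltS R).
exists u => w L wL wu; rewrite lang_detector.
have wlt q : q < L -> letter w q = None by move=> qL; rewrite /letter wL // enum_rankK.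
split=> [ng|[q [r [/andP[qr rL] Tr]]] G]; last first.
  by apply: (good_gap G qr) Tr; apply: wlt => //; exact: ltn_trans rL.
apply: contrapT => no; apply: ng.
have TL q : evtime w (L + q) = (after w L + cell_time R q)%R.
  have [<- _] := hu q; rewrite /evtime -addnS; elim: q.+1 => [|i IHi].
    by rewrite addn0 after0 addr0.
  by rewrite addnS !afterS IHi wu addrA.
have G := encoded_good (after w L) rec.
apply: (good_of_good_cells (c := encoded e n W) (L := L)) => //.
- by rewrite (_ : (fun q => _) = fun q => after w L + cell_time R q)%R //; apply/funext.
- by move=> q; rewrite /letter wu; have [_ ->] := hu q; rewrite enum_rankK.
- by move=> q r qrL Tr; apply: no; exists q, r.
Qed.

Lemma reduce_determinizable n : B n <-> determinizable R (reduce n).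
Proof.
split=> [Bn|[D detD eD]].
  exists (universal_tba _); first exact: universal_deterministic.
  by rewrite lang_universal reduce_universal.
apply: contrapT => /reduce_unit_gap[u hu].
exact: (unit_gap_not_deterministic hu detD eD).
Qed.

Lemma reduce_complementable n : B n <-> complementable R (reduce n).
Proof.
split=> [Bn|[D eD]].
  by exists (empty_tba _); rewrite lang_empty reduce_universal // setCT.
apply: contrapT => /reduce_unit_gap[u hu].
exact: (unit_gap_not_lang_compl hu eD).
Qed.

End Reduction.

Theorem theorem9 (R : realType) :
  pi11_hard tba_code [set A : tba_instance | determinizable R (tagged A)] /\
  pi11_hard tba_code [set A : tba_instance | complementable R (tagged A)].
Proof.
split=> B /pi11_arithmetical[p arith_p B_p];
  exists (fun n => existT _ _ (reduction p n)); do ?exact: computable_reduction.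
- by move=> n; exact: reduce_determinizable.
- by move=> n; exact: reduce_complementable.
Qed.
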